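(* Fix $0<\theta<\frac16$. Then $$P_N\left(S^{\searrow}(N)\right)=\frac{1}{4\pi}\,\frac{N^{-3}}{\left(\frac{(N-t_2-j_2)-(N-t_1-j_1)}{N}\right)^{3/2}\left(\frac{N-t_1-j_1}{N}\right)^{3/2}\left(1-\frac{N-t_2-j_2}{N}\right)^{3/2}}\left(1+O\!\left(N^{3\theta-1/2}\right)\right)$$ for $0\prec\!\prec j_2\prec\!\prec j_1\prec\!\prec N-t_1\prec\!\prec N-t_2\prec\!\prec N$. Explicitly: for every $\epsilon>0$ there exist constants $C$ and $N_1$ (depending on $\epsilon$ and $\theta$) such that for all integers $N\ge N_1$ and $j_1,j_2,t_1,t_2$ with $\min\{j_2,\;j_1-j_2,\;N-t_1-j_1,\;t_1-t_2,\;t_2\}>\epsilon N$, one has $$P_N\left(S^{\searrow}(N)\right)=\frac{1}{4\pi}\,\frac{N^{-3}}{\left(\frac{(N-t_2-j_2)-(N-t_1-j_1)}{N}\right)^{3/2}\left(\frac{N-t_1-j_1}{N}\right)^{3/2}\left(1-\frac{N-t_2-j_2}{N}\right)^{3/2}}\left(1+\delta\right)$$ for some real number $\delta=\delta(N,t_1,t_2,j_1,j_2)$ with $|\delta|\le CN^{3\theta-1/2}$.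
   Context: $S_N(312)$ is the set of permutations $\sigma=\sigma_1\ldots\sigma_N$ of $1,\dots,N$ for which there are no indices $i_1<i_2<i_3$ with $\sigma_{i_1}>\sigma_{i_3}>\sigma_{i_2}$. $P_N$ is the uniform probability distribution on $S_N(312)$. For $j_2<j_1<N-t_1<N-t_2$, $S^{\searrow}(N)=\{\sigma\in S_N(312):\sigma_{N-t_1}=j_1,\ \sigma_{N-t_2}=j_2\}$. The notation $f(N)\prec\!\prec g(N)$ means that there is an $\epsilon>0$ such that $g(N)-f(N)>\epsilon N$ for all sufficiently large $N$; $O$-terms under such conditions are uniform for each fixed $\epsilon$, as spelled out in the claim. *)

(* Defs.v *)
From mathcomp Require Import all_boot all_order all_fingroup all_algebra.
From mathcomp Require Import all_classical all_reals all_analysis.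

Set Implicit Arguments.
Unset Strict Implicit.
Unset Printing Implicit Defensive.

Import Order.TTheory GRing.Theory Num.Theory.
Local Open Scope ring_scope.

Definition avoids312 (N : nat) (s : 'S_N) : bool :=
  ~~ [exists i1 : 'I_N, exists i2 : 'I_N, exists i3 : 'I_N,
       [&& (i1 < i2)%N, (i2 < i3)%N, (s i3 < s i1)%N & (s i2 < s i3)%N]].

Definition S312 (N : nat) : {set 'S_N} := [set s | avoids312 s].

(* s_i = j in one-line notation, positions and values being numbered from 1;
   false when i or j lies outside 1, ..., N. *)
Definition entry_is (N : nat) (s : 'S_N) (i j : nat) : bool :=
  [exists k : 'I_N, (k.+1 == i) && ((s k).+1 == j)].

Definition Sdown (N t1 t2 j1 j2 : nat) : {set 'S_N} :=
  [set s in S312 N | entry_is s (N - t1) j1 & entry_is s (N - t2) j2].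

(* The uniform probability on S312 N, as a function of events. *)
Definition P312 (R : realType) (N : nat) (A : {set 'S_N}) : R :=
  #|A :&: S312 N|%:R / #|S312 N|%:R.

(* Main.v *)
Require Import Defs.
From HB Require Import structures.
From mathcomp Require Import all_boot all_order all_fingroup all_algebra.
From mathcomp Require Import all_classical all_reals all_analysis.
From mathcomp Require Import zify ring lra.

Set Implicit Arguments.
Unset Strict Implicit.
Unset Printing Implicit Defensive.

Import Order.TTheory GRing.Theory Num.Theory.
Import numFieldNormedType.Exports.

(** Counting.  A word avoiding 312 splits at its least letter [m] as [u m v]
    with every letter of [u] smaller than every letter of [v]; iterating,
    avoiding words of length [n] are binary trees with [n] nodes, the entry in
    place [i] with value [j] being the node of inorder rank [i] and preorder
    rank [j].  Suppose that such a node is reached from the root with [h] left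
    steps.  The subtrees hanging from the path form one forest before the node
    and one after it, both counted by ballot numbers, and the left subtree of
    the node has [i - j + h] nodes.  If a later entry is smaller, its node is an
    ancestor whose left subtree contains the earlier one.  Hence, with
    [a = j2 - 1], [b = j1 - j2 - 1], [c = t1 - t2 - 1], [d = t2] and
    [x = N - t1 - j1], the event has exactly
      [sum_h B_a(h) B_d(h) sum_k B_b(k) B_c(k) Cat(x + h + k + 1)]
    elements among [Cat(N)] ([card_Sdown], [card_S312]).

    Decoupling.  [Cat(x + 1 + l)] is [4 ^ l Cat(x + 1)] up to a relative error
    [O(l / x)], so the double sum is [Cat(x + 1) S(a, d) S(b, c)], where
    [S(a, d) = sum_h 4 ^ h B_a(h) B_d(h)], as soon as [h] is of order [sqrt N]
    on average ([nested_sum_bounds], [coupled_first_moment_le]).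

    The sum [S(a, d)].  Since [(a + 1) B_a(h) = (h + 1) 'C(2a - h, a)], it is a
    second moment of [g(h) = 4 ^ h 'C(2a - h, a) 'C(2d - h, d)].  Because
    [g(h) - g(h + 1)] is close to [h g(h) (a + d) / (2 a d)], summation by parts
    expresses the moments of [g] by [g(0)] and [sum_h g(h)].  Put [s = a + d].
    Comparing [g(2j + 1)] and [g(2j + 2)] with the term of index [j] in
    Vandermonde's sum for ['C(2s, s)] gives
    [sum_h g(h) <= 'C(2s, s) + 2 g(0)] ([total_moment_le]).  On the other hand,
    [sum_h g(h)] decreases when [(a, d)] is made less balanced with [s] fixed,
    and equals ['C(2s, s)] at [d = 0] ([total_moment_ge]).  As
    [g(0) / 'C(2s, s) = O(N^(-1/2))], this gives
    [S(a, d) = 2 'C(2s, s) / s (1 + O(N^(-1/2)))] ([coupled_bounds]).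

    Conclusion.  Wallis' inequalities turn the central binomials into powers.
    Of the four factors [sqrt pi], three from the numerator and one from
    [Cat(N)], a single factor [pi] survives; the powers of 4 leave [1 / 4].  The
    error obtained is [O(N^(-1/2))], which is at most
    [O(N^(3 * theta - 1 / 2))]. *)

(** * Ballot numbers *)

(** The number of nonnegative lattice paths from 0 to [h] with [a] up steps and
    [a - h] down steps, given by the reflection principle.  The guard matters
    only at [a = 0], where the truncated subtraction would give 1 for every
    [h]. *)
Definition ballot (a h : nat) : nat :=
  if h <= a then 'C(a.*2 - h, a) - 'C(a.*2 - h, a.+1) else 0.

Lemma ballotE a h : h <= a ->
  ballot a h = 'C(a.*2 - h, a) - 'C(a.*2 - h, a.+1).
Proof. by rewrite /ballot => ->. Qed.

Definition catalan (n : nat) : nat := ballot n 0.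

Lemma bin_succ_le n m : n <= m.*2 -> 'C(n, m.+1) <= 'C(n, m).
Proof.
move=> le_n_2m; rewrite -(leq_pmul2l (ltn0Sn m)) mul_bin_left leq_mul2r.
by apply/orP; right; lia.
Qed.

Lemma ballot_small a h : a < h -> ballot a h = 0.
Proof. by move=> lt_ah; rewrite /ballot leqNgt lt_ah. Qed.

Lemma ballot_closed a h : h <= a ->
  a.+1 * ballot a h = h.+1 * 'C(a.*2 - h, a).
Proof.
move=> le_ha; rewrite ballotE // mulnBr mul_bin_left -mulnBl; congr (_ * _); lia.
Qed.

Lemma catalanE n : n.+1 * catalan n = 'C(n.*2, n).
Proof. by rewrite ballot_closed // mul1n subn0. Qed.

(** Splits the paths according to their last step. *)
Lemma ballotS a h : ballot a.+1 h.+1 = ballot a h + ballot a.+1 h.+2.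
Proof.
have [lt_ah|le_ha] := ltnP a h; first by rewrite !ballot_small //; lia.
have [->|lt_ha] := eqVneq h a.
  rewrite (@ballot_small a.+1 a.+2) // addn0 !ballotE //.
  have -> : a.+1.*2 - a.+1 = a.+1 by lia.
  have -> : a.*2 - a = a by lia.
  by rewrite !binn !bin_small.
rewrite !ballotE; try lia.
have -> : a.+1.*2 - h.+1 = (a.*2 - h).+1 by lia.
have -> : a.+1.*2 - h.+2 = a.*2 - h by lia.
have := @bin_succ_le (a.*2 - h) a; have := @bin_succ_le (a.*2 - h) a.+1.
rewrite !binS; lia.
Qed.

Lemma ballotS0 a : ballot a.+1 0 = ballot a.+1 1.
Proof.
rewrite !ballotE // !subn0.
have -> : a.+1.*2 = a.*2.+2 by lia.
have sym : 'C(a.*2.+1, a) = 'C(a.*2.+1, a.+1).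
  by rewrite -bin_sub; [congr 'C(_, _)|]; lia.
by rewrite subSS subn0 !(binS a.*2.+1) sym subnDr.
Qed.

(** In generating functions: [u ^ h c(u) ^ (h + 1)], with [c] the Catalan
    series, counts the paths that end at height [h], and multiplying it by
    [u c(u)] raises [h] by one.  Both sides obey [ballotS], so the identity
    follows by descending induction on [h] from the range where both vanish. *)
Lemma ballot_conv a h :
  \sum_(k < a.+1) ballot k h * catalan (a - k) = ballot a.+1 h.+1.
Proof.
elim: a h => [|a IHa] h.
  by rewrite big_ord1 subnn; case: h => [|h] //.
have big_h k : a.+1 < k ->
    \sum_(i < a.+2) ballot i k * catalan (a.+1 - i) = ballot a.+2 k.+1.
  move=> lt_ak; rewrite big1 ?ballot_small // => i _.
  by rewrite ballot_small //; have := ltn_ord i; lia.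
have [m] := ubnP (a.+2 - h); elim: m h => // m IHm h le_m.
have [/big_h //|le_ha] := ltnP a.+1 h.
rewrite ballotS -IHm; last by lia.
rewrite [LHS]big_ord_recl [in RHS]big_ord_recl /=.
case: h le_m le_ha => [|h] le_m le_ha.
  rewrite (@ballot_small 0 1) // mul0n add0n {1}ballotE // bin0 mul1n.
  rewrite [catalan _]/(ballot _ _); congr (_ + _); apply: eq_bigr => i _.
  by rewrite /bump add1n ballotS0.
rewrite !(@ballot_small 0) // !mul0n !add0n -IHa -big_split /=.
by apply: eq_bigr => i _; rewrite /bump add1n ballotS mulnDl subSS.
Qed.

Lemma catalan_rec n :
  catalan n.+1 = \sum_(k < n.+1) catalan k * catalan (n - k).
Proof. by rewrite /catalan ballotS0 -ballot_conv. Qed.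

(** Splits the nonempty paths by their first return to 0: a path either never
    returns, or starts with an up step, an excursion and a down step. *)
Lemma ballot_first_return a h :
  ballot a.+1 h = (if h is h'.+1 then ballot a h' else 0) +
    \sum_(k < a.+1) catalan k * ballot (a - k) h.
Proof.
rewrite (reindex_inj rev_ord_inj) /=.
under eq_bigr => k _ do rewrite subSS subKn -1?ltnS // mulnC.
by rewrite ballot_conv; case: h => [|h]; rewrite ?ballotS0 // ballotS.
Qed.

(** * Binary trees and their marked nodes *)

Inductive tree := Leaf | Node of tree & tree.

Lemma tree_comparable : comparable tree.
Proof. by rewrite /comparable /decidable; decide equality. Qed.

HB.instance Definition _ := hasDecEq.Build tree (compareP tree_comparable).

Fixpoint tsize t := if t is Node l r then (tsize l + tsize r).+1 else 0.

(** The second argument is the number of nodes; the fuel only makes the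
    recursion on the sizes of both subtrees structural. *)
Fixpoint trees_fuel f n : seq tree :=
  match n, f with
  | 0, _ => [:: Leaf]
  | n'.+1, f'.+1 =>
      flatten [seq [seq Node l r | l <- trees_fuel f' k, r <- trees_fuel f' (n' - k)]
              | k <- iota 0 n'.+1]
  | _, _ => [::]
  end.

Definition trees n := trees_fuel n n.

Lemma trees_fuelS f n : trees_fuel f.+1 n.+1 =
  flatten [seq [seq Node l r | l <- trees_fuel f k, r <- trees_fuel f (n - k)]
          | k <- iota 0 n.+1].
Proof. by []. Qed.

Lemma trees_fuelE f n : n <= f -> trees_fuel f n = trees n.
Proof.
rewrite /trees; have [m] := ubnP n; elim: m n f => // m IHm [|n] [|f] // lt_nm le_nf.
rewrite !trees_fuelS; congr flatten; apply/eq_in_map => k; rewrite mem_iota => k_lt.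
rewrite !(IHm _ f) ?(IHm _ n) //; lia.
Qed.

Lemma big_treesS n (F : tree -> nat) :
  \sum_(t <- trees n.+1) F t =
  \sum_(k < n.+1) \sum_(l <- trees k) \sum_(r <- trees (n - k)) F (Node l r).
Proof.
rewrite /trees trees_fuelS big_flatten big_map -[iota 0 n.+1]/(index_iota 0 n.+1) big_mkord.
by apply: eq_bigr => k _; rewrite big_allpairs_dep !trees_fuelE ?leq_subr -1?ltnS.
Qed.

(** Counting multiplicities gives membership and the absence of repetitions at
    the same time. *)
Lemma count_mem_trees t n : count_mem t (trees n) = (tsize t == n).
Proof.
elim: t n => [|l IHl r IHr] [|n].
- by rewrite /trees /= eqxx.
- rewrite -sum1_count big_mkcond big_treesS big1 // => k _.
  by rewrite big1 // => l _; rewrite big1 // => r _ /=; case: eqP.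
- by rewrite /trees /=; case: eqP.
rewrite -sum1_count big_mkcond big_treesS /=.
transitivity (\sum_(k < n.+1) (tsize l == k) * (tsize r == n - k)).
  apply: eq_bigr => k _; rewrite -IHl -IHr -!sum1_count big_distrl /= [RHS]big_mkcond.
  apply: eq_bigr => l' _; rewrite mul1n.
  rewrite [X in _ = if _ then X else _]big_mkcond /=.
  have [->|ne_l] := eqVneq l' l.
    apply: eq_bigr => r' _; congr (if _ then _ else _).
    by apply/eqP/eqP => [[->]|->].
  by rewrite big1 // => r' _; case: eqP => // -[eq_l]; rewrite eq_l eqxx in ne_l.
have [lt_l|ge_l] := ltnP (tsize l) n.+1.
  rewrite (bigD1 (Ordinal lt_l)) //= eqxx mul1n big1 ?addn0; last first.
    by move=> k; rewrite -val_eqE /= eq_sym => /negPf->.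
  by congr (nat_of_bool _); lia.
rewrite big1 => [|k _]; first by case: eqP => //; lia.
by case: eqP => // eq_k; have := ltn_ord k; lia.
Qed.

Lemma mem_trees t n : (t \in trees n) = (tsize t == n).
Proof. by rewrite -has_pred1 has_count count_mem_trees; case: eqP. Qed.

Lemma trees_uniq n : uniq (trees n).
Proof. by apply: count_mem_uniq => t; rewrite count_mem_trees mem_trees. Qed.

Lemma size_trees n : size (trees n) = catalan n.
Proof.
have [m] := ubnP n; elim: m n => // m IHm [|n] lt_nm //.
rewrite -sum1_size big_treesS catalan_rec; apply: eq_bigr => k _.
have lt_k := ltn_ord k.
rewrite (eq_bigr (fun=> catalan (n - k))) => [|l _]; last first.
  by rewrite sum1_size IHm //; lia.
rewrite big_const_seq count_predT iter_addn_0 IHm; last by lia.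
exact: mulnC.
Qed.

(** The left subtree of the node whose inorder rank is [i] and preorder rank is
    [j], both counted from 0; [None] if no node has these ranks. *)
Fixpoint node_at t i j : option tree :=
  if t isn't Node l r then None else
  if j is j'.+1 then
    if i < tsize l then node_at l i j'
    else if (tsize l < i) && (tsize l <= j') then
      node_at r (i - (tsize l).+1) (j' - tsize l)
    else None
  else if i == tsize l then Some l else None.

Definition hits (E : pred tree) i j t : bool :=
  if node_at t i j is Some l then E l else false.

(** The nodes of the left subtree of a node come just before it in inorder.
    The nodes before it in inorder which are not in this subtree also come
    before it in preorder. *)
Lemma node_at_lt t i j l : node_at t i j = Some l ->
  [/\ i < tsize t, j < tsize t, i <= j + tsize l & tsize l <= i].
Proof.
elim: t i j => // lt IHl rt IHr i [|j] /=.
  by case: eqP => // -> [<-]; split; lia.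
case: ifP => [_ /IHl[h1 h2 h3 h4]|_]; first by split; lia.
by case: ifP => // lts /IHr[h1 h2 h3 h4]; split; lia.
Qed.

(** A node that comes before another in inorder and after it in preorder lies in
    the left subtree of the latter.  There, inorder ranks are shifted by the
    rank [i2 - tsize l] of the first node of the subtree, and preorder ranks by
    [j2.+1]. *)
Lemma node_at_nested t i2 j2 l i1 j1 : node_at t i2 j2 = Some l ->
  i1 < i2 -> j2 < j1 -> i2 <= i1 + tsize l ->
  node_at t i1 j1 = node_at l (i1 + tsize l - i2) (j1 - j2).-1.
Proof.
elim: t i2 j2 i1 j1 => // lt IHl rt IHr i2 [|j2] i1 [|j1] //= .
  case: eqP => // -> [<-] -> _ _.
  by rewrite addnK.
case: ifP => [lt_i2 /IHl IH lt_i lt_j le_i|_].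
  by rewrite (ltn_trans lt_i lt_i2) IH // subSS.
case: ifP => // lts /[dup] /node_at_lt[_ lt_j2 _ ge_i2] /IHr IH lt_i lt_j le_i.
have lt_i1 : tsize lt < i1.
  by lia.
have -> : i1 < tsize lt = false by lia.
have -> : (tsize lt < i1) && (tsize lt <= j1) by lia.
rewrite IH; try lia.
congr (node_at l _ _); lia.
Qed.

Lemma sum_trees_const n c : \sum_(t <- trees n) c = catalan n * c.
Proof. by rewrite big_const_seq count_predT size_trees iter_addn_0 mulnC. Qed.

Lemma big_treesS_size n (F : tree -> nat) (G : nat -> tree -> tree -> nat) :
    (forall l r, F (Node l r) = G (tsize l) l r) ->
  \sum_(t <- trees n.+1) F t =
  \sum_(0 <= k < n.+1) \sum_(l <- trees k) \sum_(r <- trees (n - k)) G k l r.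
Proof.
move=> FE; rewrite big_treesS big_mkord; apply: eq_bigr => k _.
apply: eq_big_seq => l; rewrite mem_trees => /eqP <-.
by apply: eq_bigr => r _; rewrite FE.
Qed.

Lemma sum_hits0 E n i : i <= n ->
  \sum_(t <- trees n.+1) hits E i 0 t = count E (trees i) * catalan (n - i).
Proof.
move=> le_in.
rewrite (@big_treesS_size _ _ (fun k l _ => (i == k) * E l)); last first.
  by move=> l r; rewrite /hits /=; case: eqP; rewrite ?mul1n.
rewrite big_mkord (bigD1 (Ordinal (le_in : i < n.+1))) //= [X in _ + X]big1.
  rewrite addn0 eqxx -sum1_count big_distrl [RHS]big_mkcond /=; apply: eq_bigr => l _.
  by rewrite sum_trees_const mulnC mul1n; case: (E l).
move=> k; rewrite -val_eqE /= eq_sym => /negPf->.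
by rewrite big1 // => l _; rewrite big1.
Qed.

(** A node other than the root is in the left subtree, of size [k + i.+1], or in
    the right one, when the left subtree has [k <= j] nodes. *)
Lemma sum_hitsS E n i j : j < i -> i <= n ->
  \sum_(t <- trees n.+1) hits E i j.+1 t =
    \sum_(k < j.+1) catalan k * \sum_(r <- trees (n - k)) hits E (i - k.+1) (j - k) r +
    \sum_(k < n - i) (\sum_(l <- trees (k + i.+1)) hits E i j l) * catalan (n - i - k.+1).
Proof.
move=> lt_ji le_in.
rewrite (@big_treesS_size _ _ (fun k l r => if i < k then hits E i j l : nat else
    if (k < i) && (k <= j) then hits E (i - k.+1) (j - k) r : nat else 0)); last first.
  move=> l r; rewrite /hits /=; case: ifP => // _; by case: ifP.
rewrite (@big_cat_nat _ _ _ j.+1) //=; last by lia.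
congr (_ + _).
  rewrite big_mkord; apply: eq_bigr => k _; have lt_k := ltn_ord k.
  rewrite -sum_trees_const; apply: eq_bigr => l _; apply: eq_bigr => r _.
  have -> : (i < k) = false by lia.
  by have -> : (k < i) && (k <= j) by lia.
rewrite (@big_cat_nat _ _ _ i.+1) //=; last by lia.
rewrite [X in X + _]big_nat_cond [X in X + _]big1 ?add0n; last first.
  move=> k; rewrite andbT => /andP[lt_jk lt_ki].
  rewrite big1 // => l _; rewrite big1 // => r _.
  have -> : (i < k) = false by lia.
  by have -> : (k < i) && (k <= j) = false by lia.
rewrite -{1}[i.+1]add0n big_addn subSS big_mkord; apply: eq_bigr => k _.
rewrite big_distrl; apply: eq_bigr => l _ /=.
rewrite mulnC -sum_trees_const.
have -> : n - i - k.+1 = n - (k + i.+1) by lia.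
by apply: eq_bigr => r _; have -> : i < k + i.+1 by lia.
Qed.

(** The path from the root to the node makes some number [h] of left steps.  The
    left subtrees hanging from it, cut at the left steps, form a sequence of
    [h + 1] trees, whence the factor [ballot j h]; the right subtrees give
    [ballot (n.-1 - i) h]; and the left subtree of the node itself has
    [i - j + h] nodes.  In the induction, descending to the right is the second
    term of [ballot_first_return] in [j], and descending to the left is the
    first one together with [ballot_conv] in [n - i].  The bound [M] only has
    to exceed [j]; leaving it free absorbs the shift of [h] on the left. *)
Lemma sum_hits E n i j M : j <= i -> i < n -> j < M ->
  \sum_(t <- trees n) hits E i j t =
  \sum_(h < M) ballot j h * ballot (n.-1 - i) h * count E (trees (i - j + h)).
Proof.
elim/ltn_ind: n i j M => -[//|n] IHn i [|j] [//|M] le_ji lt_in lt_jM.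
  rewrite sum_hits0 // big_ord_recl big1 => [|h _]; last first.
    by rewrite ballot_small.
  by rewrite /= subn0 !addn0 -[ballot 0 0]/1 mul1n mulnC.
rewrite sum_hitsS //=.
have eq1 (k : 'I_j.+1) : \sum_(r <- trees (n - k)) hits E (i - k.+1) (j - k) r =
    \sum_(h < M.+1) ballot (j - k) h * ballot (n - i) h * count E (trees (i - j.+1 + h)).
  have lt_k := ltn_ord k.
  rewrite (IHn _ _ _ _ M.+1); try lia.
  apply: eq_bigr => h _; congr (_ * ballot _ h * count E (trees _)); lia.
have eq2 (k : 'I_(n - i)) : \sum_(l <- trees (k + i.+1)) hits E i j l =
    \sum_(h < M) ballot j h * ballot k h * count E (trees (i - j + h)).
  have lt_k := ltn_ord k.
  rewrite (IHn _ _ _ _ M); try lia.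
  apply: eq_bigr => h _; congr (_ * ballot _ h * count E (trees _)); lia.
under eq_bigr => k _ do rewrite eq1 big_distrr /=.
under [X in _ + X]eq_bigr => k _ do rewrite eq2 big_distrl /=.
rewrite exchange_big [X in _ + X]exchange_big /=.
under [RHS]eq_bigr => h _ do rewrite ballot_first_return !mulnDl.
rewrite big_split /= addnC; congr (_ + _).
  rewrite [RHS]big_ord_recl !mul0n add0n; apply: eq_bigr => h _.
  have -> : i - j.+1 + bump 0 h = i - j + h by rewrite /bump; lia.
  rewrite /bump /=; case: (n - i) => [|m].
    by rewrite big_ord0 (@ballot_small 0) // muln0.
  rewrite -ballot_conv big_distrr big_distrl /=; apply: eq_bigr => k _.
  by rewrite subSS !mulnA mulnAC.
apply: eq_bigr => h _; rewrite !big_distrl /=; apply: eq_bigr => k _.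
by rewrite !mulnA.
Qed.

(** [sum_hits] applied twice, the second time inside the left subtree. *)
Lemma count_nested_hits n i1 j1 i2 j2 :
    i1 < i2 -> j2 < j1 -> j1 <= i1 -> i2 < n ->
  count (fun t => hits predT i1 j1 t && hits predT i2 j2 t) (trees n) =
  \sum_(h < j2.+1) ballot j2 h * ballot (n.-1 - i2) h *
    \sum_(k < j1 - j2) ballot (j1 - j2).-1 k * ballot (i2 - i1).-1 k *
      catalan (i1 - j1 + h + k + 1).
Proof.
move=> lt_i lt_j le_ji lt_in.
pose E l := hits predT (i1 + tsize l - i2) (j1 - j2).-1 l.
transitivity (\sum_(t <- trees n) hits E i2 j2 t).
  rewrite -sum1_count big_mkcond; apply: eq_bigr => t _ /=.
  rewrite /hits; case def_l: (node_at t i2 j2) => [l|]; last by rewrite andbF.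
  rewrite andbT /E /hits.
  have [_ _ le_i2 _] := node_at_lt def_l.
  rewrite (node_at_nested def_l) //; last by lia.
rewrite (@sum_hits _ _ _ _ j2.+1) //; last by lia.
apply: eq_bigr => h _; congr (_ * _).
rewrite -sum1_count big_mkcond.
rewrite (eq_big_seq (fun l => hits predT (i1 - j2 + h) (j1 - j2).-1 l : nat)); last first.
  move=> l; rewrite mem_trees /= => /eqP sz_l.
  rewrite {1}/E sz_l.
  have -> : i1 + (i2 - j2 + h) - i2 = i1 - j2 + h by lia.
  by case: hits.
rewrite (@sum_hits _ _ _ _ (j1 - j2)); try lia.
apply: eq_bigr => k _; rewrite count_predT size_trees; congr (_ * ballot _ k * catalan _); lia.
Qed.

(** * Words avoiding 312 and binary trees *)

(** [x], [y], [z] in this order do not form the pattern 312. *)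
Definition no_rise_below (x y z : nat) : bool := ~~ ((y < z) && (z < x)).

Fixpoint avoid (s : seq nat) : bool :=
  if s is x :: s' then pairwise (no_rise_below x) s' && avoid s' else true.

Lemma avoid_catr s1 s2 : avoid (s1 ++ s2) -> avoid s2.
Proof. by elim: s1 => //= x s1 IH /andP[_ /IH]. Qed.

Lemma avoid_catl s1 s2 : avoid (s1 ++ s2) -> avoid s1.
Proof.
elim: s1 => //= x s1 IH /andP[]; rewrite pairwise_cat => /and3P[_ -> _] /IH.
by move->.
Qed.

(** The least letter [m] can only play the role of 1 in the pattern 312, which
    needs a letter before [m] larger than a letter after it. *)
Lemma avoid_cat_min m s1 s2 : {in s1, forall x, m < x} ->
  {in s1 & s2, forall x y, x < y} -> {in s2, forall y, m < y} ->
  avoid s1 -> avoid s2 -> avoid (s1 ++ m :: s2).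
Proof.
have above x s : {in s, forall y, x < y} -> pairwise (no_rise_below x) s.
  elim: s => //= y s IH lt_xs; apply/andP; split; last first.
    by apply: IH => z s_z; apply: lt_xs; rewrite inE s_z orbT.
  apply/allP => z s_z; have := lt_xs z; rewrite inE s_z orbT => /(_ isT).
  rewrite /no_rise_below; lia.
move=> m_lt1 lt12 m_lt2; elim: s1 m_lt1 lt12 => [|x s1 IH] m_lt1 lt12 /=.
  by move=> _ ->; rewrite andbT; apply: above.
move=> /andP[px1 av1] av2; apply/andP; split; last first.
  apply: IH => // [y s1y|y z s1y]; first by apply: m_lt1; rewrite inE s1y orbT.
  by apply: lt12; rewrite inE s1y orbT.
have x2 : {in s2, forall y, x < y} by move=> y; apply: lt12; rewrite inE eqxx.
rewrite pairwise_cat px1 /= above // andbT; apply/andP; split.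
  apply/allrelP => y z s1y; rewrite inE => /predU1P[->|/x2].
    have := m_lt1 y; rewrite inE s1y orbT => /(_ isT); rewrite /no_rise_below; lia.
  rewrite /no_rise_below; lia.
by apply/allP => z /x2; rewrite /no_rise_below; lia.
Qed.

(** The root is the least letter; the left subtree is written before it with the
    next smaller letters, the right subtree after it with the remaining ones.
    So letters are preorder ranks and places are inorder ranks. *)
Fixpoint word m t : seq nat :=
  if t is Node l r then word m.+1 l ++ m :: word (m + (tsize l).+1) r else [::].

Lemma size_word m t : size (word m t) = tsize t.
Proof. by elim: t m => //= l IHl r IHr m; rewrite size_cat /= IHl IHr addnS. Qed.

Lemma perm_word m t : perm_eq (word m t) (iota m (tsize t)).
Proof.
elim: t m => //= l IHl r IHr m.
rewrite -cat1s perm_catCA /= perm_cons iotaD perm_cat ?IHl //.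
by rewrite addSnnS IHr.
Qed.

Lemma mem_word m t x : (x \in word m t) = (m <= x < m + tsize t).
Proof. by rewrite (perm_mem (perm_word m t)) mem_iota. Qed.

Lemma word_avoid m t : avoid (word m t).
Proof.
elim: t m => //= l IHl r IHr m; apply: avoid_cat_min => //.
- by move=> x; rewrite mem_word => /andP[].
- by move=> x y; rewrite !mem_word; lia.
by move=> y; rewrite mem_word; lia.
Qed.

(** The place of the least letter is the size of the left subtree. *)
Lemma word_inj m : injective (word m).
Proof.
move=> t; elim: t m => [|l IHl r IHr] m [|l' r'] //= eq_w.
- by move/(congr1 size): eq_w; rewrite size_cat /= addnS.
- by move/(congr1 size): eq_w; rewrite size_cat /= addnS.
have m_notin t : m \notin word m.+1 t by rewrite mem_word ltnn.
have eq_l : tsize l = tsize l'.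
  have /= := congr1 (index m) eq_w; rewrite !index_cat !(negPf (m_notin _)) /= eqxx.
  by rewrite !size_word !addn0.
move/eqP: eq_w; rewrite eqseq_cat ?size_word // eqseq_cons eq_l.
by case/and3P => /eqP/IHl-> _ /eqP/IHr->.
Qed.

(** Sorting both halves sorts the whole word, and a sorted permutation of an
    interval is that interval. *)
Lemma perm_iota_cat m n s1 s2 : perm_eq (s1 ++ s2) (iota m n) ->
    {in s1 & s2, forall x y, x < y} ->
  perm_eq s1 (iota m (size s1)) /\ perm_eq s2 (iota (m + size s1) (size s2)).
Proof.
move=> perm_s lt12.
have def_n : n = size s1 + size s2.
  by rewrite -(size_iota m n) -(perm_size perm_s) size_cat.
have sorted_s : sorted leq (sort leq s1 ++ sort leq s2).
  rewrite sorted_pairwise; last exact: leq_trans.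
  rewrite pairwise_cat -!sorted_pairwise; try exact: leq_trans.
  rewrite !sort_sorted ?andbT; try exact: leq_total.
  by apply/allrelP => x y; rewrite !mem_sort => x1 y2; rewrite ltnW ?lt12.
have eq_s : sort leq s1 ++ sort leq s2 = iota m n.
  apply: (sorted_eq leq_trans anti_leq) => //; first exact: iota_sorted.
  by apply: perm_trans perm_s; rewrite perm_cat // perm_sort.
move/eqP: eq_s; rewrite def_n iotaD eqseq_cat ?size_sort ?size_iota //.
by case/andP => /eqP<- /eqP<-; rewrite ![perm_eq _ (sort _ _)]perm_sym !perm_sort.
Qed.

(** Avoiding 312 forces every letter before the least one to be smaller than
    every letter after it, so both sides are words on intervals. *)
Lemma word_surj m s : perm_eq s (iota m (size s)) -> avoid s ->
  exists2 t, tsize t = size s & word m t = s.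
Proof.
have [n] := ubnP (size s); elim: n m s => // n IHn m s lt_n perm_s av_s.
have [/size0nil->|s_gt0] := posnP (size s); first by exists Leaf.
have s_m : m \in s by rewrite (perm_mem perm_s) mem_iota; lia.
case/splitPr: s / s_m lt_n perm_s av_s s_gt0 => s1 s2.
rewrite size_cat /= => lt_n perm_s av_s _.
have mem_s x : (x \in s1 ++ m :: s2) = (m <= x < m + (size s1 + (size s2).+1)).
  by rewrite (perm_mem perm_s) mem_iota.
have uniq_s : uniq (s1 ++ m :: s2) by rewrite (perm_uniq perm_s) iota_uniq.
have [m1 m2] : m \notin s1 /\ m \notin s2.
  move: uniq_s; rewrite cat_uniq /= negb_or; case/and3P => _ /andP[-> _].
  by case/andP.
have gt_m x : x \in s1 ++ s2 -> m < x.
  rewrite mem_cat => s_x; rewrite ltn_neqAle; apply/andP; split.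
    by apply/eqP => eq_m; move: s_x; rewrite -eq_m (negPf m1) (negPf m2).
  by have := mem_s x; rewrite mem_cat inE orbCA s_x orbT => /esym/andP[].
have lt12 : {in s1 & s2, forall x y, x < y}.
  move=> x y s1x s2y; have m_y : m < y by apply: gt_m; rewrite mem_cat s2y orbT.
  have ne_xy : x != y.
    apply/eqP => eq_xy; move: uniq_s; rewrite cat_uniq => /and3P[_ /hasPn/(_ y) + _].
    by rewrite inE s2y orbT -eq_xy s1x => /(_ isT).
  have: no_rise_below x m y.
    case/splitPr: s1x av_s => s3 s4; rewrite -catA => /avoid_catr /= /andP[+ _].
    rewrite pairwise_cat /= => /and4P[_ _ + _] => /allP/(_ y s2y) //.
  by rewrite /no_rise_below m_y /=; lia.
have perm12 : perm_eq (s1 ++ s2) (iota m.+1 (size s1 + size s2)).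
  by move: perm_s; rewrite -cat1s perm_catCA /= addnS /= perm_cons.
have [perm1 perm2] := perm_iota_cat perm12 lt12.
have lt1 : size s1 < n by rewrite -ltnS (leq_ltn_trans _ lt_n) // addnS ltnS leq_addr.
have lt2 : size s2 < n by rewrite -ltnS (leq_ltn_trans _ lt_n) // leq_addl.
have [l sz_l word_l] := IHn _ _ lt1 perm1 (avoid_catl av_s).
have := @avoid_catr [:: m] s2 (avoid_catr av_s).
case/(IHn _ _ lt2 perm2) => r sz_r word_r.
by exists (Node l r); rewrite /= ?word_l sz_l ?sz_r ?addnS // -addSn -word_r.
Qed.

Lemma nth_word m t i j : i < tsize t ->
  (nth 0 (word m t) i == m + j) = hits predT i j t.
Proof.
elim: t m i j => // l IHl r IHr m i j /= lt_i; rewrite /hits nth_cat size_word /=.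
case: ltnP => [lt_il|le_li].
  case: j => [|j]; first rewrite addn0.
    have -> : (i == tsize l) = false by lia.
    have: nth 0 (word m.+1 l) i \in word m.+1 l by rewrite mem_nth ?size_word.
    by rewrite mem_word; case: eqP => // ->; rewrite ltnn.
  by rewrite -addSnnS IHl.
have [->|ne_il] := eqVneq i (tsize l).
  rewrite subnn /= -{1}[m]addn0 eqn_add2l eq_sym; case: j => //= j.
  by rewrite ltnn.
have lt_li : tsize l < i by lia.
rewrite (_ : i - tsize l = (i - (tsize l).+1).+1) /=; last by lia.
have lt_r : i - (tsize l).+1 < tsize r by lia.
have nlt : (i < tsize l) = false by lia.
case: j => [|j] /=; rewrite ?(negPf ne_il) ?nlt ?lt_li; last case: (leqP (tsize l) j) => [le_lj|lt_jl] /=.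
- have: nth 0 (word (m + (tsize l).+1) r) (i - (tsize l).+1) \in word (m + (tsize l).+1) r.
    by rewrite mem_nth ?size_word.
  by rewrite mem_word; lia.
- have := IHr (m + (tsize l).+1) _ (j - tsize l) lt_r; rewrite /hits => <-.
  congr (_ == _); lia.
have: nth 0 (word (m + (tsize l).+1) r) (i - (tsize l).+1) \in word (m + (tsize l).+1) r.
  by rewrite mem_nth ?size_word.
by rewrite mem_word; lia.
Qed.

Lemma avoidP s : reflect
  (forall i j k, i < j -> j < k -> k < size s ->
     no_rise_below (nth 0 s i) (nth 0 s j) (nth 0 s k)) (avoid s).
Proof.
elim: s => [|x s IHs] /=; first by constructor.
apply: (iffP andP) => [[/(pairwiseP 0) px /IHs av_s]|av_s].
  move=> [|i] [|j] [|k] //= lt_ij lt_jk lt_k; last exact: av_s.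
  by apply: px => //; rewrite inE; lia.
split; last by apply/IHs => i j k lt_ij lt_jk lt_k; apply: (av_s i.+1 j.+1 k.+1).
by apply/(pairwiseP 0) => j k _ k_lt lt_jk; apply: (av_s 0 j.+1 k.+1).
Qed.

Definition one_line N (s : 'S_N) : seq nat := [seq val (s k) | k <- enum 'I_N].

Lemma size_one_line N (s : 'S_N) : size (one_line s) = N.
Proof. by rewrite size_map size_enum_ord. Qed.

Lemma nth_one_line N (s : 'S_N) (k : 'I_N) : nth 0 (one_line s) k = s k.
Proof. by rewrite (nth_map k) ?size_enum_ord // nth_ord_enum. Qed.

Lemma one_line_inj N : injective (@one_line N).
Proof.
move=> s1 s2 eq_w; apply/permP => k; apply: val_inj.
by rewrite /= -!nth_one_line eq_w.
Qed.

Lemma perm_one_line N (s : 'S_N) : perm_eq (one_line s) (iota 0 N).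
Proof.
rewrite /one_line map_comp -val_enum_ord perm_map // uniq_perm ?enum_uniq //.
  by rewrite map_inj_uniq ?enum_uniq //; apply: perm_inj.
move=> k; rewrite mem_enum -[k](permKV s) mem_map; last exact: perm_inj.
by rewrite mem_enum.
Qed.

Lemma one_line_surj N w : perm_eq w (iota 0 N) -> exists s : 'S_N, one_line s = w.
Proof.
move=> perm_w; have sz_w : size w = N by rewrite (perm_size perm_w) size_iota.
have lt_w (k : 'I_N) : nth 0 w k < N.
  have: nth 0 w k \in w by rewrite mem_nth ?sz_w.
  by rewrite (perm_mem perm_w) mem_iota.
have f_inj : injective (fun k => Ordinal (lt_w k)).
  move=> k1 k2 /(congr1 val) /= /eqP; rewrite nth_uniq ?sz_w //.
    by move/eqP/val_inj.
  by rewrite (perm_uniq perm_w) iota_uniq.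
exists (perm f_inj); apply: (@eq_from_nth _ 0); rewrite size_one_line // => i lt_i.
by rewrite -[i]/(val (Ordinal lt_i)) nth_one_line permE.
Qed.

Lemma avoids312E N (s : 'S_N) : avoids312 s = avoid (one_line s).
Proof.
apply/negP/avoidP => [av i j k lt_ij lt_jk|av].
  rewrite size_one_line => lt_k; apply/negP => /andP[lt1 lt2]; apply: av.
  have lt_j := ltn_trans lt_jk lt_k; have lt_i := ltn_trans lt_ij lt_j.
  apply/existsP; exists (Ordinal lt_i); apply/existsP; exists (Ordinal lt_j).
  apply/existsP; exists (Ordinal lt_k); rewrite -!nth_one_line /=.
  by apply/and4P.
case/existsP => i /existsP[j /existsP[k /and4P[lt_ij lt_jk lt1 lt2]]].
have := av i j k lt_ij lt_jk; rewrite size_one_line !nth_one_line => /(_ (ltn_ord k)).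
by rewrite /no_rise_below lt1 lt2.
Qed.

(** Injective images of the permutations and of the trees are duplicate-free
    lists with the same elements. *)
Lemma card_S312_word N (E : pred (seq nat)) :
  #|[set s in S312 N | E (one_line s)]| = count (fun t => E (word 0 t)) (trees N).
Proof.
rewrite -size_filter -(size_map (word 0)) cardE -(size_map (@one_line N)).
apply/perm_size/uniq_perm.
- by rewrite map_inj_uniq ?enum_uniq //; apply: one_line_inj.
- by rewrite map_inj_uniq ?filter_uniq ?trees_uniq //; apply: word_inj.
move=> w; apply/mapP/mapP => [[s]|[t]].
  rewrite mem_enum !inE avoids312E => /andP[av_s E_s] ->.
  have [] := @word_surj 0 (one_line s); rewrite ?size_one_line ?perm_one_line //.
  move=> t sz_t word_t; exists t => //.
  by rewrite mem_filter mem_trees sz_t eqxx word_t E_s.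
rewrite mem_filter mem_trees => /andP[E_t /eqP sz_t] ->.
have [|s def_s] := @one_line_surj N (word 0 t); first by rewrite -sz_t perm_word.
by exists s; rewrite // mem_enum !inE avoids312E def_s word_avoid.
Qed.

Lemma card_S312 N : #|S312 N| = catalan N.
Proof.
rewrite -size_trees -count_predT -(card_S312_word N xpredT).
by apply: eq_card => s; rewrite !inE andbT.
Qed.

Lemma entry_isE N (s : 'S_N) i j : i < N ->
  entry_is s i.+1 j.+1 = (nth 0 (one_line s) i == j).
Proof.
move=> lt_i; apply/existsP/eqP => [[k /andP[/eqP[<-] /eqP[<-]]]|<-].
  by rewrite nth_one_line.
by exists (Ordinal lt_i); rewrite (nth_one_line s (Ordinal lt_i)) !eqxx.
Qed.

(** The parameters are the numbers of letters or places strictly between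
    consecutive marks: [a] letters below [j2], [b] between [j2] and [j1], [c]
    places between the two marks, [d] after the second; [x = N - t1 - j1] is the
    excess of the place of the first mark over its letter. *)
Lemma card_Sdown a b c d x :
  let N := x + a + b + c + d + 3 in
  #|Sdown N (c + d).+1 d (a + b).+2 a.+1| =
  \sum_(h < a.+1) ballot a h * ballot d h *
    \sum_(k < b.+1) ballot b k * ballot c k * catalan (x + h + k + 1).
Proof.
move=> N.
have lt1 : N - (c + d).+1 = (x + a + b).+2 by lia.
have lt2 : N - d = (x + a + b + c).+3 by lia.
transitivity (count (fun t => hits predT (x + a + b).+1 (a + b).+1 t &&
    hits predT (x + a + b + c).+2 a t) (trees N)).
  pose E w := (nth 0 w (x + a + b).+1 == (a + b).+1) &&
    (nth 0 w (x + a + b + c).+2 == a).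
  transitivity #|[set s in S312 N | E (one_line s)]|.
    by apply: eq_card => s; rewrite !inE lt1 lt2 !entry_isE //; lia.
  rewrite card_S312_word; apply: eq_in_count => t; rewrite mem_trees => /eqP sz_t.
  by rewrite /E -!(@nth_word 0) ?add0n ?sz_t //; lia.
rewrite count_nested_hits; try lia.
apply: eq_bigr => h _.
have -> : N.-1 - (x + a + b + c).+2 = d by lia.
congr (_ * _).
have -> : ((a + b).+1 - a) = b.+1 by lia.
apply: eq_bigr => k _; congr (ballot _ k * ballot _ k * catalan _); lia.
Qed.

Local Open Scope ring_scope.

(** * Sums of products of binomial coefficients *)

Section BinomialSums.
Variable R : realFieldType.

(** Up to the factor [4 ^ a], this is the law of the number of matches left in
    one box when the other is found empty in Banach's matchbox problem.  It is
    close to one half of a centred normal law of variance [2 a]. *)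
Definition scaled_bin (a h : nat) : R :=
  if (h <= a)%N then 2 ^+ h * ('C(a.*2 - h, a))%:R else 0.

Lemma scaled_bin_ge0 a h : 0 <= scaled_bin a h.
Proof. by rewrite /scaled_bin; case: ifP => // _; rewrite mulr_ge0 ?exprn_ge0 ?ler0n. Qed.

Lemma scaled_bin_small a h : (a < h)%N -> scaled_bin a h = 0.
Proof. by rewrite /scaled_bin ltnNge => /negPf->. Qed.

Lemma scaled_bin0 a : scaled_bin a 0 = ('C(a.*2, a))%:R.
Proof. by rewrite /scaled_bin /= expr0 mul1r subn0. Qed.

Lemma scaled_bin_step a h : (h <= a)%N ->
  (2 * a%:R - h%:R) * scaled_bin a h.+1 = 2 * (a%:R - h%:R) * scaled_bin a h.
Proof.
rewrite leq_eqVlt => /predU1P[->|lt_ha]; first by rewrite scaled_bin_small // subrr; ring.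
rewrite /scaled_bin lt_ha ltnW //.
have := mul_bin_down (a.*2 - h) a.
have -> : ((a.*2 - h).-1 = a.*2 - h.+1)%N by lia.
have -> : (a.*2 - h - a = a - h)%N by lia.
move/(congr1 (fun n => n%:R : R)); rewrite !natrM !natrB ?(ltnW lt_ha) //; last by lia.
rewrite -muln2 natrM exprS => binE.
transitivity (2 * 2 ^+ h * ((a%:R * 2 - h%:R) * ('C(a * 2 - h.+1, a))%:R) : R); first ring.
by rewrite binE; ring.
Qed.

(** Pascal's rule; it expresses the row [a] by the row [a.+1], which lets
    [total_moment_shift] compare two rows whose total index is the same. *)
Lemma scaled_bin_pascal a h : 4 * scaled_bin a h = 2 * scaled_bin a.+1 h.+1 - scaled_bin a.+1 h.+2.
Proof.
have [lt_ah|le_ha] := ltnP a h; first by rewrite !scaled_bin_small //; [ring | lia..].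
have [->|lt_ha] := eqVneq h a.
  rewrite (@scaled_bin_small a.+1 a.+2) // /scaled_bin !leqnn.
  have -> : (a.+1.*2 - a.+1 = a.+1)%N by lia.
  have -> : (a.*2 - a = a)%N by lia.
  by rewrite !binn exprS; ring.
have h_lt : (h < a)%N by rewrite ltn_neqAle lt_ha.
rewrite /scaled_bin le_ha !ltnS le_ha h_lt.
have -> : (a.+1.*2 - h.+1 = (a.*2 - h).+1)%N by lia.
have -> : (a.+1.*2 - h.+2 = a.*2 - h)%N by lia.
by rewrite binS natrD !exprS; ring.
Qed.

Lemma scaled_bin1 a : (0 < a)%N -> scaled_bin a 1 = scaled_bin a 0.
Proof.
move=> a_gt0; have /= := @scaled_bin_step a 0 isT; rewrite !subr0.
by apply: mulfI; rewrite mulf_neq0 // pnatr_eq0 // -lt0n.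
Qed.

(** The ratio of consecutive terms shows the Gaussian decay
    [exp (- h ^ 2 / (4 a))] in discrete form. *)
Lemma scaled_bin_drop a h : (0 < a)%N -> (h <= a)%N ->
  scaled_bin a h - scaled_bin a h.+1 = h%:R / (2 * a%:R - h%:R) * scaled_bin a h.
Proof.
move=> a_gt0 le_ha.
have nz : 2 * a%:R - h%:R != 0 :> R.
  by rewrite subr_eq0 -natrM eqr_nat; lia.
apply: (mulfI nz); rewrite mulrBr scaled_bin_step //; field.
by [].
Qed.

Lemma scaled_bin_drop_ge0 a h : 0 <= scaled_bin a h - scaled_bin a h.+1.
Proof.
have [lt_ah|le_ha] := ltnP a h; first by rewrite !scaled_bin_small ?subrr // ltnW.
have [a0|a_gt0] := posnP a.
  by move: le_ha; rewrite a0 leqn0 => /eqP ->; rewrite (@scaled_bin_small 0 1) // subr0 scaled_bin_ge0.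
rewrite scaled_bin_drop // mulr_ge0 ?scaled_bin_ge0 // divr_ge0 //.
by rewrite subr_ge0 -natrM ler_nat; lia.
Qed.

(** The sum runs to [d] but may be taken to any larger bound, and is symmetric in
    [a] and [d]: terms with [h > a] or [h > d] vanish. *)
Definition moment (w : nat -> R) a d := \sum_(h < d.+1) w h * (scaled_bin a h * scaled_bin d h).

Lemma moment_widen (w : nat -> R) a d M : (d < M)%N ->
  \sum_(h < M) w h * (scaled_bin a h * scaled_bin d h) = moment w a d.
Proof.
move=> lt_dM; rewrite /moment -!(big_mkord xpredT (fun h => w h * (scaled_bin a h * scaled_bin d h))).
rewrite (@big_cat_nat _ _ _ d.+1) //= [X in _ + X]big_nat_cond [X in _ + X]big1 ?addr0 //.
by move=> h; rewrite andbT => /andP[lt_dh _]; rewrite (@scaled_bin_small d) // !mulr0.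
Qed.

Lemma momentC w a d : moment w a d = moment w d a.
Proof.
rewrite -(@moment_widen w a d (a + d).+1); last by lia.
rewrite -(@moment_widen w d a (a + d).+1); last by lia.
by apply: eq_bigr => h _; rewrite [scaled_bin a h * _]mulrC.
Qed.

Lemma ler_moment w1 w2 a d : (forall h, (h <= a)%N -> (h <= d)%N -> w1 h <= w2 h) ->
  moment w1 a d <= moment w2 a d.
Proof.
move=> le_w; apply: ler_sum => h _.
have [lt_ah|le_ha] := ltnP a h; first by rewrite scaled_bin_small // mul0r !mulr0.
have [lt_dh|le_hd] := ltnP d h; first by rewrite (@scaled_bin_small d) // !mulr0.
by rewrite ler_wpM2r ?le_w // mulr_ge0 ?scaled_bin_ge0.
Qed.

Lemma momentD w1 w2 a d :
  moment (fun h => w1 h + w2 h) a d = moment w1 a d + moment w2 a d.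
Proof. by rewrite -big_split; apply: eq_bigr => h _; rewrite mulrDl. Qed.

Lemma momentZ c w a d : moment (fun h => c * w h) a d = c * moment w a d.
Proof. by rewrite [RHS]big_distrr; apply: eq_bigr => h _; rewrite [RHS]mulrA. Qed.

Lemma eq_moment w1 w2 a d : w1 =1 w2 -> moment w1 a d = moment w2 a d.
Proof. by move=> eq_w; apply: eq_bigr => h _; rewrite eq_w. Qed.

(** Summation by parts. *)
Lemma moment_abel (w : nat -> R) a d :
  \sum_(h < d.+1) w h.+1 * (scaled_bin a h * scaled_bin d h - scaled_bin a h.+1 * scaled_bin d h.+1) =
  moment (fun h => w h.+1 - w h) a d + w 0%N * (scaled_bin a 0 * scaled_bin d 0).
Proof.
pose g h := scaled_bin a h * scaled_bin d h.
suff abel M : \sum_(h < M) w h.+1 * (g h - g h.+1) =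
    \sum_(h < M) (w h.+1 - w h) * g h + w 0%N * g 0%N - w M * g M.
  by rewrite abel /g (@scaled_bin_small d d.+1) // !mulr0 subr0.
elim: M => [|M IHM]; first by rewrite !big_ord0; ring.
by rewrite !big_ord_recr /= IHM; ring.
Qed.

(** A likelihood ratio inequality: by [scaled_bin_drop] and [scaled_bin_step], the ratio of the
    drops at [h + 1] and [h] is [2 (h + 1) / h * (e - h) / (2 e - h - 1)] in row
    [e], which is nondecreasing in [e]. *)
Lemma scaled_bin_drop_ratio a d h : (0 < d)%N -> (d <= a)%N ->
  (scaled_bin a h - scaled_bin a h.+1) * (scaled_bin d h.+1 - scaled_bin d h.+2) <=
  (scaled_bin a h.+1 - scaled_bin a h.+2) * (scaled_bin d h - scaled_bin d h.+1).
Proof.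
move=> d_gt0 le_da; have a_gt0 := leq_trans d_gt0 le_da.
case: h => [|h]; first by rewrite !scaled_bin1 // !subrr mul0r mulr0.
have [le_dh|lt_hd] := leqP d h.+1.
  rewrite (@scaled_bin_small d h.+2) // (@scaled_bin_small d h.+3) ?subrr ?mulr0; last by lia.
  by rewrite mulr_ge0 ?scaled_bin_drop_ge0 // subr0 scaled_bin_ge0.
have lt_ha := leq_trans lt_hd le_da.
have stepE e : (h.+1 < e)%N ->
    scaled_bin e h.+2 = 2 * (e%:R - h.+1%:R) / (2 * e%:R - h.+1%:R) * scaled_bin e h.+1.
  move=> lt_he; have nz : 2 * e%:R - h.+1%:R != 0 :> R.
    by rewrite subr_eq0 -natrM eqr_nat; lia.
  by apply: (mulfI nz); rewrite scaled_bin_step ?(ltnW lt_he) //; field; rewrite nat1r.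
rewrite (@scaled_bin_drop a h.+2) // (@scaled_bin_drop d h.+2) // !(@scaled_bin_drop _ h.+1) ?(ltnW lt_ha) ?(ltnW lt_hd) //.
rewrite (stepE a) // (stepE d) //.
have := scaled_bin_ge0 a h.+1; have := scaled_bin_ge0 d h.+1.
move: (scaled_bin a h.+1) (scaled_bin d h.+1) => A D D_ge0 A_ge0.
have den e : (h.+1 < e)%N -> 0 < 2 * e%:R - h.+2%:R :> R.
  by move=> lt_he; rewrite subr_gt0 -natrM ltr_nat; lia.
have den' e : (h.+1 < e)%N -> 0 < 2 * e%:R - h.+1%:R :> R.
  by move=> lt_he; rewrite subr_gt0 -natrM ltr_nat; lia.
move: (den a lt_ha) (den d lt_hd) (den' a lt_ha) (den' d lt_hd).
have H2 : h.+2%:R = h%:R + 2 :> R by rewrite -addn2 natrD.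
have H1 : h.+1%:R = h%:R + 1 :> R by rewrite -addn1 natrD.
have le_da' : d%:R <= a%:R :> R by rewrite ler_nat.
have h_ge0 : 0 <= h%:R :> R by [].
rewrite H2 H1; move: (h%:R) h_ge0 (a%:R) (d%:R) le_da' => H H_ge0 x y le_yx.
move=> den_x den_y den_x' den_y'.
have le_l : (y - (H + 1)) / (2 * y - (H + 2)) <= (x - (H + 1)) / (2 * x - (H + 2)).
  by rewrite ler_pdivrMr // mulrAC ler_pdivlMr //; nra.
pose c : R := 2 * (H + 2) * (H + 1) * A * D / (2 * x - (H + 1)) / (2 * y - (H + 1)).
have c_ge0 : 0 <= c.
  apply: divr_ge0; last exact: ltW.
  by apply: divr_ge0; [rewrite !mulr_ge0 //; lra | exact: ltW].
have := ler_wpM2l c_ge0 le_l; rewrite /c.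
by congr (_ <= _); field; rewrite ?lt0r_neq0.
Qed.

(** By [scaled_bin_pascal] four times the difference of the two sums is the sum over [h] of the
    2 x 2 minors compared in [scaled_bin_drop_ratio], plus a telescoping sum which vanishes
    at both ends. *)
Lemma total_moment_shift a d : (0 < d)%N -> (d <= a)%N ->
  moment (fun=> 1) a d.-1 <= moment (fun=> 1) a.-1 d.
Proof.
case: d => // d _; case: a => // a; rewrite ltnS => le_da /=.
rewrite -(@moment_widen _ a.+1 d d.+2) // -(@moment_widen _ a d.+1 d.+2) //.
rewrite -(ler_pM2l (ltr0Sn R 3)) -subr_ge0 !big_distrr -sumrB /=.
pose A := scaled_bin a.+1; pose D := scaled_bin d.+1.
(* The telescoping part. *)
pose W h := A h * D h.+1 - A h.+1 * D h.
have W_end : W d.+2 = 0 by rewrite /W /D !scaled_bin_small // !mulr0 subrr.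
have W_start : W 0%N = 0 by rewrite /W /A /D !scaled_bin1 // mulrC subrr.
have -> : \sum_(h < d.+2) (4 * (1 * (scaled_bin a h * scaled_bin d.+1 h)) -
      4 * (1 * (scaled_bin a.+1 h * scaled_bin d h))) =
    \sum_(h < d.+2) ((A h.+1 - A h.+2) * (D h - D h.+1) -
      (A h - A h.+1) * (D h.+1 - D h.+2)) + \sum_(h < d.+2) (W h.+1 - W h).
  rewrite -big_split; apply: eq_bigr => h _ /=.
  transitivity ((4 * scaled_bin a h) * scaled_bin d.+1 h - scaled_bin a.+1 h * (4 * scaled_bin d h)); first ring.
  by rewrite !scaled_bin_pascal /W /A /D; ring.
rewrite -(big_mkord xpredT (fun h => W h.+1 - W h)) telescope_sumr // W_end W_start.
by rewrite subrr addr0 sumr_ge0 // => h _; rewrite subr_ge0 scaled_bin_drop_ratio.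
Qed.

(** Moving [d] to 0 while keeping [a + d] can only decrease the sum, by
    [total_moment_shift]; at [d = 0] the sum has one term. *)
Lemma total_moment_ge a d : ('C((a + d).*2, a + d))%:R <= moment (fun=> 1) a d.
Proof.
wlog le_da : a d / (d <= a)%N.
  by move=> W; have [/W//|/ltnW/W] := leqP d a; rewrite addnC momentC.
elim: d a le_da => [|d IHd] a le_da.
  by rewrite /moment big_ord1 mul1r !scaled_bin0 bin0 mulr1 addn0.
have := IHd a.+1; rewrite addSnnS => /(_ _)/le_trans; apply; first by lia.
by apply: (@total_moment_shift a.+1 d.+1) => //; lia.
Qed.

(** Both sides behave like [exp (- j ^ 2 / a)].  Comparing at the odd index
    [2 j + 1] rather than at [2 j] makes the inequality hold without a
    correction; it is an equality at [j = 0] if [a] is positive. *)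
Lemma scaled_bin_odd_le a j : scaled_bin a (j.*2).+1 <= ('C(a.*2, a + j))%:R.
Proof.
elim: j => [|j IHj].
  have [->|a_gt0] := posnP a; first by rewrite scaled_bin_small.
  by rewrite scaled_bin1 // scaled_bin0 addn0.
have [lt_aj|le_ja] := ltnP a (j.+1.*2).+1; first by rewrite scaled_bin_small.
have ge2 : (j.*2.+2 <= a)%N by lia.
have ge3 : (j.*2.+3 <= a)%N by lia.
have s1 := @scaled_bin_step a j.*2.+1 (ltnW ge2); have s2 := @scaled_bin_step a j.*2.+2 ge2.
have /(congr1 (fun n => n%:R : R)) := mul_bin_left a.*2 (a + j).
rewrite !natrM natrB; last by lia.
rewrite doubleS addnS; move: IHj s1 s2.
set u := scaled_bin a j.*2.+1; set v := scaled_bin a j.*2.+2; set w := scaled_bin a j.*2.+3.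
set B : R := ('C(_, a + j))%:R; set B' : R := ('C(_, (a + j).+1))%:R.
pose x : R := (a - j.*2.+2)%:R.
have x_ge1 : 1 <= x by rewrite ler1n; lia.
have j_ge0 : 0 <= j%:R :> R by [].
have aE : a%:R = x + 2 * j%:R + 2.
  by rewrite /x natrB // -addn2 natrD -mul2n natrM; ring.
have -> : (a + j).+1%:R = x + 3 * j%:R + 3 :> R by rewrite -addn1 !natrD aE; ring.
rewrite -[a.*2]mul2n !natrM natrD -[j.*2.+2]addn2 -[j.*2.+1]addn1 !natrD -mul2n natrM aE.
move=> IHj s1 s2 sB.
have u_ge0 : 0 <= u by apply: scaled_bin_ge0.
have s2' : (2 * x + 2 * j%:R + 2) * w = 2 * x * v by lra.
have s1' : (2 * x + 2 * j%:R + 3) * v = 2 * (x + 1) * u by lra.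
have -> : w = 2 * x / (2 * x + 2 * j%:R + 2) * v.
  have nz : 2 * x + 2 * j%:R + 2 != 0 by rewrite gt_eqF //; lra.
  by apply: (mulfI nz); rewrite s2'; field.
have -> : v = 2 * (x + 1) / (2 * x + 2 * j%:R + 3) * u.
  have nz : 2 * x + 2 * j%:R + 3 != 0 by rewrite gt_eqF //; lra.
  by apply: (mulfI nz); rewrite s1'; field.
have -> : B' = (x + j%:R + 2) / (x + 3 * j%:R + 3) * B.
  have nz : x + 3 * j%:R + 3 != 0 by rewrite gt_eqF //; lra.
  have sB' : (x + 3 * j%:R + 3) * B' = (x + j%:R + 2) * B by lra.
  by apply: (mulfI nz); rewrite sB'; field.
rewrite mulrA; apply: ler_pM => //.
  by rewrite mulr_ge0 // divr_ge0; lra.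
rewrite mulf_div ler_pdivrMr; last by rewrite mulr_gt0; lra.
rewrite [leRHS]mulrAC ler_pdivlMr; last by lra.
nra.
Qed.

(** Vandermonde's convolution centred at its largest term. *)
Lemma central_Vandermonde a d :
  (\sum_(j < d.+1) 'C(a.*2, a + j) * 'C(d.*2, d + j) +
   \sum_(j < a) 'C(a.*2, a + j.+1) * 'C(d.*2, d + j.+1) = 'C((a + d).*2, a + d))%N.
Proof.
have sym n j : (j <= n -> 'C(n.*2, n - j) = 'C(n.*2, n + j))%N.
  by move=> le_jn; rewrite -bin_sub; [congr 'C(_, _)|]; lia.
rewrite addnC doubleD -binomial.Vandermonde -addnS big_split_ord /=.
congr addn.
  rewrite (reindex_inj rev_ord_inj) /=; apply: eq_bigr => j _; have lt_j := ltn_ord j.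
  rewrite -sym; last by lia.
  by congr muln; congr 'C(_, _); lia.
apply: eq_bigr => j _; have lt_j := ltn_ord j; congr muln.
rewrite -sym; last by lia.
by congr 'C(_, _); lia.
Qed.

(** The terms of index [2 j + 1] and [2 j + 2] are both at most the product
    bounded by [scaled_bin_odd_le].  These products, counted twice, make up
    [central_Vandermonde] plus once more the central term. *)
Lemma total_moment_le a d : moment (fun=> 1) a d <=
  ('C((a + d).*2, a + d))%:R + 2 * (scaled_bin a 0 * scaled_bin d 0).
Proof.
pose g h := scaled_bin a h * scaled_bin d h.
pose w j : R := ('C(a.*2, a + j) * 'C(d.*2, d + j))%:R.
have g_le_w j : g j.*2.+1 <= w j by rewrite /w natrM ler_pM ?scaled_bin_ge0 ?scaled_bin_odd_le.
have g_decr h : g h.+1 <= g h.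
  by rewrite ler_pM ?scaled_bin_ge0 // -subr_ge0 scaled_bin_drop_ge0.
have pairs M : \sum_(h < M.*2.+1) g h <= g 0%N + 2 * \sum_(j < M) w j.
  elim: M => [|M IHM]; first by rewrite big_ord1 big_ord0; lra.
  rewrite doubleS 2!big_ord_recr /= [X in _ <= _ + 2 * X]big_ord_recr /=.
  by have := g_le_w M; have := g_decr M.*2.+1; lra.
rewrite -(@moment_widen _ a d (a + d).+1.*2.+1); last by lia.
under eq_bigr do rewrite mul1r.
apply: le_trans (pairs _) _.
rewrite -central_Vandermonde natrD !natr_sum -/(g 0%N).
have w_out j : ((a < j) || (d < j))%N -> w j = 0.
  case/orP => lt_j; rewrite /w natrM.
    by rewrite (@bin_small _ (a + j)) ?mul0r //; lia.
  by rewrite (@bin_small _ (d + j)) ?mulr0 //; lia.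
have w0 : w 0%N = g 0%N by rewrite /w /g !scaled_bin0 !addn0 natrM.
have sumw M : (forall j, (M <= j)%N -> w j = 0) -> (M <= (a + d).+1)%N ->
    \sum_(j < (a + d).+1) w j = \sum_(j < M) w j.
  move=> w_out_M le_M; rewrite -!(big_mkord xpredT w) (@big_cat_nat _ _ _ M) //=.
  rewrite [X in _ + X]big_nat_cond [X in _ + X]big1 ?addr0 // => j.
  by rewrite andbT => /andP[/w_out_M].
have sum_d : \sum_(j < (a + d).+1) w j = \sum_(j < d.+1) w j.
  by apply: sumw => [j lt_dj|]; [rewrite w_out ?lt_dj ?orbT | lia].
have sum_a : \sum_(j < (a + d).+1) w j = g 0%N + \sum_(j < a) w j.+1.
  rewrite (sumw a.+1) ?big_ord_recl ?w0 // => [j lt_aj|]; last by lia.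
  by rewrite w_out ?lt_aj.
rewrite -/(\sum_(j < d.+1) w j) -/(\sum_(j < a) w j.+1) -/(g 0%N) -sum_d.
move: sum_a; lra.
Qed.

End BinomialSums.

(** * Moments by summation by parts *)

Section Moments.
Variable R : realFieldType.
Variables a d : nat.
Hypotheses (a_gt0 : (0 < a)%N) (d_gt0 : (0 < d)%N).
Notation g h := (scaled_bin R a h * scaled_bin R d h).

(** The product of two rows behaves like [exp (- decay * h ^ 2 / 2)]. *)
Definition decay : R := (a%:R + d%:R) / (2 * a%:R * d%:R).

Lemma decay_gt0 : 0 < decay.
Proof. by rewrite divr_gt0 ?mulr_gt0 ?addr_gt0 ?ltr0n. Qed.

(** The discrete form of [- g' = decay * h * g].  The lower bound is exact, since
    [(a + d) ^ 2 >= 4 a d] and [2 h <= a + d]; the excess is of higher order in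
    [h]. *)
Lemma drop_bounds h :
  decay * h%:R * g h <= g h - g h.+1 <= (decay * h%:R + 4 * decay ^+ 2 * h%:R ^+ 2) * g h.
Proof.
have [lt_ah|le_ha] := ltnP a h.
  by rewrite !(@scaled_bin_small _ a) ?(leq_trans lt_ah) // !mul0r !mulr0 subrr lexx.
have [lt_dh|le_hd] := ltnP d h.
  by rewrite !(@scaled_bin_small _ d) ?(leq_trans lt_dh) // !mulr0 subrr lexx.
have stepE e : (0 < e)%N -> (h <= e)%N ->
    scaled_bin R e h.+1 = (1 - h%:R / (2 * e%:R - h%:R)) * scaled_bin R e h.
  by move=> e_gt0 /(scaled_bin_drop R e_gt0)/(congr1 (fun z => scaled_bin R e h - z)); lra.
rewrite (stepE a) // (stepE d) //.
have g_ge0 : 0 <= g h by rewrite mulr_ge0 ?scaled_bin_ge0.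
have x_ge : h%:R <= a%:R :> R by rewrite ler_nat.
have y_ge : h%:R <= d%:R :> R by rewrite ler_nat.
have x_gt0 : 0 < a%:R :> R by rewrite ltr0n.
have y_gt0 : 0 < d%:R :> R by rewrite ltr0n.
have h_ge0 : 0 <= h%:R :> R by [].
have factor u v A D : A * D - u * A * (v * D) = (1 - u * v) * (A * D) :> R by ring.
rewrite /decay factor.
move: (h%:R) (a%:R) (d%:R) (g h) g_ge0 x_ge y_ge x_gt0 y_gt0 h_ge0.
move=> H x y G G_ge0 le_Hx le_Hy x_gt0 y_gt0 H_ge0.
have xH : 0 < 2 * x - H by lra.
have yH : 0 < 2 * y - H by lra.
have -> : 1 - (1 - H / (2 * x - H)) * (1 - H / (2 * y - H)) =
    H * ((2 * (x + y) - 3 * H) / ((2 * x - H) * (2 * y - H))).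
  by field; rewrite ?lt0r_neq0.
set q := (2 * (x + y) - 3 * H) / ((2 * x - H) * (2 * y - H)).
have xy_gt0 : 0 < x * y by rewrite mulr_gt0.
have D_gt0 : 0 < (2 * x - H) * (2 * y - H) by rewrite mulr_gt0.
have excess : q - (x + y) / (2 * x * y) =
    H * (4 * (x + y) ^+ 2 - 12 * x * y - 2 * (x + y) * H) /
      (4 * x * y * ((2 * x - H) * (2 * y - H))).
  by rewrite /q; field; rewrite ?lt0r_neq0.
have num_ge0 : 0 <= 4 * (x + y) ^+ 2 - 12 * x * y - 2 * (x + y) * H.
  have : 0 <= (x + y) * (x + y - 2 * H) by rewrite mulr_ge0; lra.
  have := sqr_ge0 (x - y); lra.
have q_ge : (x + y) / (2 * x * y) <= q.
  rewrite -subr_ge0 excess divr_ge0 ?mulr_ge0 //; lra.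
have q_le : q <= (x + y) / (2 * x * y) + 4 * ((x + y) / (2 * x * y)) ^+ 2 * H.
  rewrite -lerBlDl excess.
  have -> : 4 * ((x + y) / (2 * x * y)) ^+ 2 * H = H * (4 * (x + y) ^+ 2) / (4 * x * y * (x * y)).
    by field; rewrite ?lt0r_neq0.
  have le_D : x * y <= (2 * x - H) * (2 * y - H) by rewrite ler_pM ?(ltW x_gt0) ?(ltW y_gt0) //; lra.
  rewrite ler_pM //.
  - by rewrite mulr_ge0.
  - by rewrite invr_ge0 !mulr_ge0 ?ltW //; lra.
  - rewrite ler_wpM2l //; have : 0 <= (x + y) * H by rewrite mulr_ge0; lra.
    lra.
  by rewrite lef_pV2 ?posrE ?mulr_gt0 // ler_wpM2l // !mulr_ge0 ?ltW.
apply/andP; split; rewrite ler_wpM2r //.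
  by rewrite mulrC ler_wpM2l.
have := ler_wpM2l H_ge0 q_le; lra.
Qed.

(** Summation by parts with [drop_bounds]: it gains two powers of [h] at the price
    of a factor [1 / decay], which is how all the moments below are reduced to
    [g 0] and [moment (fun=> 1)]. *)
Lemma moment_drop_bounds (w : nat -> R) : (forall h, 0 <= w h) ->
  decay * moment (fun h => h%:R * w h.+1) a d <=
    moment (fun h => w h.+1 - w h) a d + w 0%N * g 0%N <=
  decay * moment (fun h => h%:R * w h.+1) a d +
    4 * decay ^+ 2 * moment (fun h => h%:R ^+ 2 * w h.+1) a d.
Proof.
move=> w_ge0; rewrite -moment_abel -!momentZ -momentD; apply/andP; split.
  apply: ler_sum => h _; have /andP[+ _] := drop_bounds h.
  by move/(ler_wpM2l (w_ge0 h.+1)); lra.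
apply: ler_sum => h _; have /andP[_] := drop_bounds h.
by move/(ler_wpM2l (w_ge0 h.+1)); lra.
Qed.

Lemma first_moment_le : decay * moment (fun h => h%:R) a d <= g 0%N.
Proof.
have /andP[+ _] := @moment_drop_bounds (fun=> 1) (fun=> ler01).
rewrite (@eq_moment _ _ (fun h => h%:R)) => [|h]; last by rewrite mulr1.
rewrite [X in _ <= X + _](_ : _ = 0) ?add0r ?mul1r //.
by apply: big1 => h _; rewrite subrr mul0r.
Qed.

Lemma third_moment_le : decay ^+ 2 * moment (fun h => h%:R ^+ 3) a d <= 2 * g 0%N.
Proof.
(* The weight is shifted so that its value at [h.+1] is [h ^ 2]. *)
have w_ge0 h : 0 <= (h%:R - 1) ^+ 2 :> R by rewrite sqr_ge0.
have /andP[+ _] := moment_drop_bounds w_ge0.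
rewrite (@eq_moment _ _ (fun h => h%:R ^+ 3)) => [|h]; last by rewrite -natr1; ring.
rewrite (@eq_moment _ (fun h => _ - _) (fun h => 2 * h%:R + (- 1) * 1)) => [|h]; last first.
  by rewrite -natr1; ring.
rewrite momentD !momentZ => third.
have zeroth : g 0%N <= moment (fun=> 1) a d.
  rewrite /moment big_ord_recl mul1r lerDl sumr_ge0 // => h _.
  by rewrite mul1r mulr_ge0 ?scaled_bin_ge0.
have := first_moment_le; have := decay_gt0; nra.
Qed.

(** The size of [moment (fun=> 1)], by [total_moment_ge] and [total_moment_le]. *)
Definition merged_bin : R := ('C((a + d).*2, a + d))%:R.

(** The correction in [moment_drop_bounds] is a third moment, hence a multiple of
    [g 0], which is of lower order than [merged_bin]. *)
Lemma second_moment_ge : merged_bin - 16 * g 0%N <= decay * moment (fun h => h%:R * h.+1%:R) a d.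
Proof.
have /andP[_] := @moment_drop_bounds (fun h => h%:R) (fun=> ler0n _ _).
rewrite mul0r addr0 (@eq_moment _ (fun h => _ - _) (fun=> 1)) => [|h]; last first.
  by rewrite -natr1; ring.
have le3 : moment (fun h => h%:R ^+ 2 * h.+1%:R) a d <= 2 * moment (fun h => h%:R ^+ 3 : R) a d.
  rewrite -momentZ; apply: ler_moment => -[|h] _ _; first by rewrite mulr0n !expr0n /= ?mul0r ?mulr0 ?mul0r.
  rewrite [leRHS](_ : _ = h.+1%:R ^+ 2 * (2 * h.+1%:R)); last by ring.
  by rewrite ler_wpM2l ?sqr_ge0 // -natrM ler_nat; lia.
have := third_moment_le; have := total_moment_ge R a d; rewrite -/merged_bin.
have := ler_wpM2l (sqr_ge0 decay) le3; lra.
Qed.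

Lemma square_moment_le :
  decay * moment (fun h => h.+1%:R ^+ 2) a d <= (1 + decay) * (merged_bin + 2 * g 0%N) + g 0%N.
Proof.
have /andP[+ _] := @moment_drop_bounds (fun h => h%:R) (fun=> ler0n _ _).
rewrite mul0r addr0 (@eq_moment _ (fun h => _ - _) (fun=> 1)) => [|h]; last first.
  by rewrite -natr1; ring.
rewrite (@eq_moment _ (fun h => h.+1%:R ^+ 2)
  (fun h => h%:R * h.+1%:R + (h%:R + 1))) => [|h]; last by rewrite -natr1; ring.
rewrite !momentD; have := total_moment_le R a d; rewrite -/merged_bin.
have := first_moment_le; have := decay_gt0; nra.
Qed.

Lemma square_moment_ge : merged_bin - 16 * g 0%N <= decay * moment (fun h => h.+1%:R ^+ 2) a d.
Proof.
apply: le_trans second_moment_ge _; rewrite ler_wpM2l ?(ltW decay_gt0) //.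
apply: ler_moment => h _ _; rewrite expr2 ler_wpM2r // ler_nat; lia.
Qed.

Lemma cubic_moment_le :
  decay ^+ 2 * moment (fun h => h%:R * h.+1%:R ^+ 2) a d <= 8 * g 0%N.
Proof.
apply: le_trans (_ : decay ^+ 2 * (4 * moment (fun h => h%:R ^+ 3) a d) <= _); last first.
  by have := third_moment_le; lra.
rewrite ler_wpM2l ?sqr_ge0 // -momentZ; apply: ler_moment => -[|h] _ _.
  by rewrite mulr0n !expr0n /= ?mul0r ?mulr0 ?mul0r.
rewrite [leRHS](_ : _ = h.+1%:R * (2 * h.+1%:R) ^+ 2); last by ring.
by rewrite ler_wpM2l // ler_sqr ?nnegrE ?mulr_ge0 // -natrM ler_nat; lia.
Qed.
End Moments.

Lemma scaled_bin_ballot (R : realFieldType) a h :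
  a.+1%:R * (2 ^+ h * (ballot a h)%:R) = h.+1%:R * scaled_bin R a h.
Proof.
rewrite /scaled_bin; case: leqP => [le_ha|lt_ah]; last by rewrite ballot_small // !mulr0.
rewrite mulrCA -natrM ballot_closed // natrM; ring.
Qed.

(** The ballot numbers carry the two factors [h.+1] that turn the weight 1 into a
    second moment. *)
Lemma sum_ballot_moment (R : realFieldType) (w : nat -> R) a d :
  a.+1%:R * d.+1%:R *
    (\sum_(h < d.+1) w h * (4 ^+ h * (ballot a h)%:R * (ballot d h)%:R)) =
  moment (fun h => w h * h.+1%:R ^+ 2) a d.
Proof.
rewrite big_distrr; apply: eq_bigr => h _ /=.
have -> : (4 : R) = 2 * 2 by ring.
rewrite exprMn.
transitivity (w h * (a.+1%:R * (2 ^+ h * (ballot a h)%:R)) * (d.+1%:R * (2 ^+ h * (ballot d h)%:R))).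
  by ring.
rewrite !scaled_bin_ballot; ring.
Qed.

(** * Wallis' inequalities *)

Section Wallis.
Variable R : realType.

(** The primitive of [cos ^ n] that vanishes at 0, from the reduction formula
    that integration by parts gives.  With explicit primitives, Wallis'
    integrals are just their values at [pi / 2]. *)
Fixpoint cos_primitive (n : nat) : R -> R :=
  match n with
  | 0 => id
  | 1 => @sin R
  | (n'.+1 as m).+1 => n'.+2%:R^-1 *: ((@cos R) ^+ m * @sin R + m%:R *: cos_primitive n')
  end.

Lemma is_derive_cos_primitive n (x : R) :
  is_derive x 1 (cos_primitive n) (cos x ^+ n).
Proof.
elim/ltn_ind: n => -[|[|n]] IHn.
- exact: is_derive_id.
- rewrite expr1; exact: is_derive_sin.
have dF := IHn n (ltnW (ltnSn _)).
rewrite [cos_primitive _]/=.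
have dX : is_derive x 1 ((@cos R) ^+ n.+1) ((n.+1%:R * cos x ^+ n) *: - sin x).
  exact: is_deriveX.
have dS := is_derive_sin x.
have dM := is_deriveM dX dS.
have dZ : is_derive x 1 (n.+1%:R *: cos_primitive n) (n.+1%:R *: (cos x ^+ n)).
  exact: is_deriveZ.
have dD := is_deriveD dM dZ.
apply: (@is_derive_eq _ _ _ _ _ _ _ _ (is_deriveZ _ dD)).
rewrite exprfctE /GRing.scale /=.
have nz : n.+2%:R != 0 :> R by rewrite pnatr_eq0.
apply: (mulfI nz); rewrite mulVKf //.
have : sin x * sin x * (cos x ^+ n) = (1 - cos x * cos x) * cos x ^+ n.
  by congr (_ * _); have := cos2Dsin2 x; rewrite !expr2; lra.
rewrite !exprS.
have -> : n.+2%:R = n.+1%:R + 1 :> R by rewrite -natr1.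
move: (cos x) (sin x) n.+1%:R => v w m e.
transitivity (v * v ^+ n * v - m * (w * w * v ^+ n) + m * v ^+ n); first ring.
rewrite e; ring.
Qed.

Definition cos_integral n : R := cos_primitive n (pi / 2).

Lemma cos_primitive0 n : cos_primitive n 0 = 0.
Proof.
elim/ltn_ind: n => -[|[|n]] IHn //; first exact: sin0.
rewrite /= !fctE /= IHn ?sin0 ?(ltnW (ltnSn _)) //.
by rewrite mulr0 scaler0 addr0 scaler0.
Qed.

(** The mean value theorem for the difference of the primitives, whose derivative
    [cos ^ n (1 - cos)] is nonnegative between 0 and [pi / 2]. *)
Lemma cos_integral_decr n : cos_integral n.+1 <= cos_integral n.
Proof.
pose f := cos_primitive n - cos_primitive n.+1.
have pi_ge0 : 0 <= pi / 2 :> R by rewrite divr_ge0 // pi_ge0.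
have df (x : R) : is_derive x 1 f (cos x ^+ n - cos x ^+ n.+1).
  by apply: is_deriveB; apply: is_derive_cos_primitive.
have [|c] := MVT_segment pi_ge0 (fun x _ => df x).
  by apply: derivable_within_continuous => x _; apply: ex_derive.
rewrite in_itv /= => /andP[c_ge0 c_le] fE.
rewrite -subr_ge0.
have -> : cos_integral n - cos_integral n.+1 = f (pi / 2) - f 0.
  have fE0 y : f y = cos_primitive n y - cos_primitive n.+1 y by [].
  by rewrite !fE0 !cos_primitive0 subrr subr0.
rewrite fE subr0 mulr_ge0 //.
have cos_ge0 : 0 <= cos c by apply: cos_ge0_pihalf; rewrite c_le andbT; lra.
rewrite exprS -{1}[cos c ^+ n]mul1r -mulrBl mulr_ge0 ?exprn_ge0 // subr_ge0.
Qed.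

Lemma cos_integralS n : n.+2%:R * cos_integral n.+2 = n.+1%:R * cos_integral n.
Proof.
rewrite /cos_integral /= !fctE /= /GRing.scale /= cos_pihalf exprS mul0r mul0r add0r.
by rewrite mulVKf // pnatr_eq0.
Qed.

Definition central_prob n : R := ('C(n.*2, n))%:R / 4 ^+ n.

Lemma central_probS n : 2 * n.+1%:R * central_prob n.+1 = (2 * n%:R + 1) * central_prob n.
Proof.
have /(congr1 (fun k => k%:R : R)) :
    (n.+1 * 'C(n.+1.*2, n.+1) = 2 * ((2 * n + 1) * 'C(n.*2, n)))%N.
  have -> : (2 * n + 1 = n.*2.+1)%N by lia.
  have e2 := mul_bin_down n.*2.+1 n.
  rewrite -mul_bin_diag e2 /=.
  have -> : (n.*2.+1 - n = n.+1)%N by lia.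
  by rewrite mulnA mul2n.
rewrite !natrM natrD natrM => e3; rewrite /central_prob exprS.
have nz : 4 ^+ n != 0 :> R by rewrite expf_neq0 // pnatr_eq0.
apply: (mulfI nz); transitivity ((n.+1%:R * ('C(n.+1.*2, n.+1))%:R) / 2 : R).
  by field.
by rewrite e3; field.
Qed.

Lemma central_prob0 : central_prob 0 = 1.
Proof. by rewrite /central_prob bin0 expr0 divr1. Qed.

Lemma central_prob_gt0 n : 0 < central_prob n.
Proof. by rewrite divr_gt0 ?exprn_gt0 // ltr0n bin_gt0; lia. Qed.

Lemma cos_integral_even n : cos_integral n.*2 = pi / 2 * central_prob n.
Proof.
elim: n => [|n IHn]; first by rewrite central_prob0 mulr1.
have nz : 2 * n.+1%:R != 0 :> R by rewrite mulf_neq0 ?pnatr_eq0.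
apply: (mulfI nz); rewrite [in RHS]mulrCA central_probS doubleS.
have := cos_integralS n.*2; rewrite IHn.
have -> : n.*2.+2%:R = 2 * n.+1%:R :> R by rewrite -natrM; congr _%:R; lia.
have -> : n.*2.+1%:R = 2 * n%:R + 1 :> R by rewrite -natr1 -mul2n natrM.
by move->; rewrite mulrCA.
Qed.

Lemma cos_integral_odd n : cos_integral n.*2.+1 * ((2 * n%:R + 1) * central_prob n) = 1.
Proof.
elim: n => [|n IHn].
  by rewrite central_prob0 mulr0 add0r !mulr1 /cos_integral /= sin_pihalf.
have := cos_integralS n.*2.+1; rewrite doubleS.
have -> : n.*2.+3%:R = 2 * n.+1%:R + 1 :> R by rewrite -natrM natr1; congr _%:R; lia.
have -> : n.*2.+2%:R = 2 * n.+1%:R :> R by rewrite -natrM; congr _%:R; lia.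
move=> rec; rewrite mulrA [_ * (_ + 1)]mulrC rec -mulrA mulrCA [_ * central_prob _]mulrC.
transitivity (cos_integral n.*2.+1 * (2 * n.+1%:R * central_prob n.+1)); first ring.
by rewrite central_probS.
Qed.

(** Even Wallis integrals are [pi / 2 * central_prob n], odd ones are the inverse of
    [(2 n + 1) * central_prob n]; both bounds say that consecutive integrals decrease. *)
Lemma central_prob_bounds n :
  pi * n%:R * central_prob n ^+ 2 <= 1 /\ 2 <= pi * (2 * n%:R + 1) * central_prob n ^+ 2.
Proof.
have c_gt0 := central_prob_gt0 n; have pi0 := pi_gt0 R; have n_ge0 : 0 <= n%:R :> R by [].
have d_gt0 : 0 < (2 * n%:R + 1) * central_prob n by rewrite mulr_gt0 //; lra.
have := cos_integral_decr n.*2; rewrite -(ler_pM2r d_gt0) cos_integral_odd cos_integral_even => lo.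
have := cos_integral_decr n.*2.+1.
rewrite -(ler_pM2r d_gt0) cos_integral_odd -doubleS cos_integral_even => up.
have cS := central_probS n; split; last by lra.
have up2 : pi * (2 * n%:R + 1) ^+ 2 * central_prob n ^+ 2 <= 4 * n.+1%:R.
  have -> : pi * (2 * n%:R + 1) ^+ 2 * central_prob n ^+ 2 =
     2 * (2 * n.+1%:R) * (pi / 2 * central_prob n.+1 * ((2 * n%:R + 1) * central_prob n)).
    transitivity (pi * (2 * n.+1%:R * central_prob n.+1) * ((2 * n%:R + 1) * central_prob n)).
      by rewrite cS; ring.
    by field.
  have n1 : 0 <= 2 * (2 * n.+1%:R) :> R by rewrite !mulr_ge0.
  by have := ler_wpM2l n1 up; lra.
have P_ge0 : 0 <= pi * central_prob n ^+ 2 by rewrite mulr_ge0 ?sqr_ge0 ?ltW.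
rewrite -(ler_pM2r (_ : 0 < (2 * n%:R + 1) ^+ 2)); last by rewrite exprn_gt0 //; lra.
have nS : n.+1%:R = n%:R + 1 :> R by rewrite natr1.
rewrite nS in up2; have := ler_wpM2l n_ge0 up2; lra.
Qed.
End Wallis.

(** * Approximation up to a relative error of order N^(-1/2) *)

Section Approx.
Context {R : realType} {I : Type} {F : set_system I} {FF : Filter F}.
Variable N : I -> nat.
Hypothesis N_large : forall M : nat, \forall i \near F, (M <= N i)%N.

(** The index set [I] is filtered so that the size [N i] tends to infinity. *)
Definition err (i : I) : R := (Num.sqrt (N i)%:R)^-1.

Definition approx (f g : I -> R) : Prop :=
  exists2 K : R, 0 < K & \forall i \near F, `|f i - g i| <= K * err i * g i.

Lemma err_gt0 : \forall i \near F, 0 < err i.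
Proof.
near=> i; rewrite invr_gt0 sqrtr_gt0 ltr0n.
by near: i; apply: N_large.
Unshelve. all: by end_near. Qed.

Lemma err_sqr : \forall i \near F, err i ^+ 2 * (N i)%:R = 1.
Proof.
near=> i; rewrite exprVn sqr_sqrtr // mulVf // pnatr_eq0 -lt0n.
by near: i; apply: N_large.
Unshelve. all: by end_near. Qed.

Lemma err_small (e : R) : 0 < e -> \forall i \near F, err i <= e.
Proof.
move=> e_gt0; pose M := (Num.truncn (e ^- 2)).+1.
near=> i.
have M_le : (M <= N i)%N by near: i; apply: N_large.
have E : err i ^+ 2 * (N i)%:R = 1 by near: i; apply: err_sqr.
have r_gt0 : 0 < err i by near: i; apply: err_gt0.
have M_gt : e ^- 2 <= (N i)%:R.
  apply: le_trans (_ : M%:R <= _); last by rewrite ler_nat.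
  by rewrite ltW // truncnS_gt.
have : err i ^+ 2 / e ^+ 2 <= 1 by rewrite -E ler_wpM2l ?sqr_ge0.
rewrite ler_pdivrMr ?exprn_gt0 // mul1r ler_sqr ?nnegrE //; exact: ltW.
Unshelve. all: by end_near. Qed.

(** Built into [approx], since the error bound must be nonnegative. *)
Lemma approx_ge0 f g : approx f g -> \forall i \near F, 0 <= g i.
Proof.
case=> K K_gt0 fg; near=> i.
have r_gt0 : 0 < err i by near: i; apply: err_gt0.
have : 0 <= K * err i * g i.
  by apply: le_trans (normr_ge0 (f i - g i)) _; near: i.
by rewrite pmulr_rge0 // mulr_gt0.
Unshelve. all: by end_near. Qed.

Lemma approx_eq f g : (\forall i \near F, f i = g i /\ 0 <= g i) -> approx f g.
Proof.
move=> fg; exists 1 => //; near=> i.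
have [-> g_ge0] : f i = g i /\ 0 <= g i by near: i.
rewrite subrr normr0 !mulr_ge0 //.
by apply: ltW; near: i; apply: err_gt0.
Unshelve. all: by end_near. Qed.

Lemma approxM f1 g1 f2 g2 : approx f1 g1 -> approx f2 g2 ->
  approx (fun i => f1 i * f2 i) (fun i => g1 i * g2 i).
Proof.
move=> fg1 fg2; have p1 := approx_ge0 fg1; have p2 := approx_ge0 fg2.
case: fg1 => K1 K1_gt0 fg1; case: fg2 => K2 K2_gt0 fg2.
exists (K1 * (1 + K2) + K2); first by nra.
near=> i.
have r_gt0 : 0 < err i by near: i; apply: err_gt0.
have r_le1 : err i <= 1 by near: i; apply: err_small.
have g1_ge0 : 0 <= g1 i by near: i.
have g2_ge0 : 0 <= g2 i by near: i.
have e1 : `|f1 i - g1 i| <= K1 * err i * g1 i by near: i.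
have e2 : `|f2 i - g2 i| <= K2 * err i * g2 i by near: i.
have -> : f1 i * f2 i - g1 i * g2 i =
  (f1 i - g1 i) * (f2 i - g2 i) + (f1 i - g1 i) * g2 i + g1 i * (f2 i - g2 i) by ring.
apply: le_trans (ler_normD _ _) _.
apply: le_trans (lerD (ler_normD _ _) (lexx _)) _.
rewrite !normrM (ger0_norm g1_ge0) (ger0_norm g2_ge0).
have q1 := ler_pM (normr_ge0 _) (normr_ge0 _) e1 e2.
have q2 := ler_wpM2r g2_ge0 e1; have q3 := ler_wpM2l g1_ge0 e2.
have q4 : K1 * err i * g1 i * (K2 * err i * g2 i) <= K1 * K2 * err i * (g1 i * g2 i).
  have -> : K1 * err i * g1 i * (K2 * err i * g2 i) = err i * (K1 * K2 * err i * (g1 i * g2 i)) by ring.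
  by rewrite ler_piMl // !mulr_ge0 // ltW.
lra.
Unshelve. all: by end_near. Qed.

Lemma approx_trans f g h : approx f g -> approx g h -> approx f h.
Proof.
move=> fg gh; have g_ge0 := approx_ge0 fg; have h_ge0 := approx_ge0 gh.
case: fg => K1 K1_gt0 fg; case: gh => K2 K2_gt0 gh.
exists (K1 * (1 + K2) + K2); first by nra.
near=> i.
have r_gt0 : 0 < err i by near: i; apply: err_gt0.
have r_le1 : err i <= 1 by near: i; apply: err_small.
have hi_ge0 : 0 <= h i by near: i.
have e1 : `|f i - g i| <= K1 * err i * g i by near: i.
have e2 : `|g i - h i| <= K2 * err i * h i by near: i.
rewrite (_ : f i - h i = (f i - g i) + (g i - h i)); last by ring.
apply: le_trans (ler_normD _ _) _.
have g_le : g i <= (1 + K2) * h i.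
  have : K2 * err i * h i <= K2 * h i.
    by rewrite -mulrA mulrCA ler_piMl // mulr_ge0 // ltW.
  by move: e2; rewrite ler_norml => /andP[_]; lra.
have k_ge0 : 0 <= K1 * err i by rewrite mulr_ge0 ?ltW.
by have := ler_wpM2l k_ge0 g_le; lra.
Unshelve. all: by end_near. Qed.

Lemma approxV f g : approx f g -> (\forall i \near F, 0 < g i) ->
  approx (fun i => (f i)^-1) (fun i => (g i)^-1).
Proof.
case=> K K_gt0 fg g_gt0; exists (2 * K); first by rewrite mulr_gt0.
near=> i.
have r_le : err i <= (2 * K)^-1.
  by near: i; apply: err_small; rewrite invr_gt0 mulr_gt0.
have gi_gt0 : 0 < g i by near: i.
have r_gt0 : 0 < err i by near: i; apply: err_gt0.
have e1 : `|f i - g i| <= K * err i * g i by near: i.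
have Kr : 2 * K * err i <= 1 by rewrite mulrC -ler_pdivlMr ?mulr_gt0 // mul1r.
have f_ge : g i <= 2 * f i.
  by move: e1; rewrite ler_norml => /andP[+ _]; have := ler_wpM2r (ltW gi_gt0) Kr; lra.
have f_gt0 : 0 < f i by lra.
have -> : (f i)^-1 - (g i)^-1 = - (f i - g i) / (f i * g i).
  by field; rewrite !lt0r_neq0.
rewrite normrM normrN normfV (ger0_norm (mulr_ge0 (ltW f_gt0) (ltW gi_gt0))).
rewrite ler_pdivrMr ?mulr_gt0 // (le_trans e1) //.
have -> : 2 * K * err i / g i * (f i * g i) = K * err i * (2 * f i).
  by field; rewrite lt0r_neq0.
by rewrite ler_wpM2l // mulr_ge0 ?ltW.
Unshelve. all: by end_near. Qed.

(** [|f - g| g <= |f - g| (f + g)]. *)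
Lemma approx_sqr f g : approx (fun i => f i ^+ 2) (fun i => g i ^+ 2) ->
  (\forall i \near F, 0 <= f i) -> (\forall i \near F, 0 < g i) -> approx f g.
Proof.
case=> K K_gt0 fg f_ge0 g_gt0; exists K => //; near=> i.
have fi_ge0 : 0 <= f i by near: i.
have gi_gt0 : 0 < g i by near: i.
have e1 : `|f i ^+ 2 - g i ^+ 2| <= K * err i * g i ^+ 2 by near: i.
rewrite -(ler_pM2r gi_gt0).
have -> : K * err i * g i * g i = K * err i * g i ^+ 2 by ring.
apply: le_trans e1.
rewrite subr_sqr normrM ler_wpM2l ?normr_ge0 // ger0_norm ?lerDr //.
by rewrite addr_ge0 // ltW.
Unshelve. all: by end_near. Qed.

Lemma approx_sandwich f g (K : R) : 0 < K ->
  (\forall i \near F, (1 - K * err i) * g i <= f i /\ f i <= (1 + K * err i) * g i) ->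
  approx f g.
Proof.
move=> K_gt0 H; exists K => //; near=> i.
have [lo up] : (1 - K * err i) * g i <= f i /\ f i <= (1 + K * err i) * g i by near: i.
by rewrite ler_norml; apply/andP; split; lra.
Unshelve. all: by end_near. Qed.

End Approx.

(** * Catalan numbers and central binomial coefficients *)

Section Pointwise.
Variable R : realType.
Local Notation cat n := ((catalan n)%:R : R).

Lemma bin_central_prob n : ('C(n.*2, n))%:R = 4 ^+ n * central_prob R n.
Proof. by rewrite mulrC divfK // expf_neq0 // pnatr_eq0. Qed.

Lemma catalan_central_prob n : cat n = 4 ^+ n * (central_prob R n / (n%:R + 1)).
Proof.
have nz : n%:R + 1 != 0 :> R by rewrite natr1 pnatr_eq0.
by rewrite mulrA -bin_central_prob -catalanE natrM -natr1; field.
Qed.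

Lemma catalanS n : (n%:R + 2) * cat n.+1 = (4 * n%:R + 2) * cat n.
Proof.
have := central_probS R n; rewrite !catalan_central_prob -[n.+1%:R]natr1 exprS.
have : 0 <= n%:R :> R by [].
move: (n%:R : R) (central_prob R n) (central_prob R n.+1) => x c c' x_ge0 e.
transitivity (2 * 4 ^+ n / (x + 1) * (2 * (x + 1) * c')).
  by field; rewrite !lt0r_neq0 //; lra.
by rewrite e; field; rewrite !lt0r_neq0 //; lra.
Qed.

Lemma catalan_addn_le n l : cat (n + l) <= 4 ^+ l * cat n.
Proof.
elim: l => [|l IHl]; first by rewrite addn0 expr0 mul1r.
rewrite addnS exprS -mulrA; apply: le_trans (_ : 4 * cat (n + l) <= _); last by rewrite ler_wpM2l.
have x_ge0 : 0 <= (n + l)%:R :> R by [].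
have c_ge0 : 0 <= cat (n + l) by [].
have := catalanS (n + l); move: x_ge0 c_ge0; move: ((n + l)%:R : R) (cat _) (cat _) => x c c'.
move=> x_ge0 c_ge0 e.
have p_gt0 : 0 < x + 2 by lra.
by rewrite -(ler_pM2l p_gt0) e; nra.
Qed.

(** By [catalanS] the step from [m] to [m + 1] multiplies by
    [4 (1 - 3 / (2 (m + 2)))]; the losses of [l] steps add up at most. *)
Lemma catalan_addn_ge n l : (0 < n)%N ->
  4 ^+ l * cat n * (1 - l%:R * (3 / (2 * n%:R))) <= cat (n + l).
Proof.
move=> n_gt0; have n_gt0' : 0 < n%:R :> R by rewrite ltr0n.
set t : R := 3 / (2 * n%:R).
have t_ge0 : 0 <= t by rewrite divr_ge0 // mulr_ge0.
elim: l => [|l IHl]; first by rewrite addn0 expr0 mul1r mul0r subr0 mulr1.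
have P_ge0 : 0 <= 4 ^+ l * cat n by rewrite mulr_ge0 // exprn_ge0.
have step : 4 * cat (n + l) * (1 - t) <= cat (n + l).+1.
  have x_ge : n%:R <= (n + l)%:R :> R by rewrite ler_nat leq_addr.
  have c_ge0 : 0 <= cat (n + l) by [].
  have := catalanS (n + l); move: x_ge c_ge0.
  move: ((n + l)%:R : R) (cat (n + l)) (cat _) => x c c' x_ge c_ge0 e.
  have p_gt0 : 0 < x + 2 by lra.
  have tn : 3 <= 2 * t * (x + 2).
    have -> : 3 = 2 * t * n%:R by rewrite /t; field; rewrite lt0r_neq0.
    by rewrite ler_wpM2l ?mulr_ge0 //; lra.
  rewrite -(ler_pM2l p_gt0) e.
  by have := ler_wpM2l c_ge0 tn; lra.
rewrite addnS exprS -[l.+1%:R]natr1.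
have [t1|t1] := lerP t 1; last first.
  have lt_ge0 : 0 <= l%:R * t by rewrite mulr_ge0.
  apply: le_trans (ler0n _ _); apply: mulr_ge0_le0; last by lra.
  by rewrite -mulrA mulr_ge0.
apply: le_trans step.
have u : 0 <= 1 - t by lra.
have := ler_wpM2r u IHl; have l_ge0 : 0 <= l%:R :> R by [].
have : 0 <= 4 ^+ l * cat n * (l%:R * t * t) by rewrite !mulr_ge0.
lra.
Qed.
End Pointwise.

Section Asymptotics.
Context {R : realType} {I : Type} {F : set_system I} {FF : Filter F}.
Variable N : I -> nat.
Hypothesis N_large : forall M : nat, \forall i \near F, (M <= N i)%N.
Local Notation err := (@err R I N).
Local Notation approx := (@approx R I F N).
Variable kappa : R.
Hypothesis kappa_gt0 : 0 < kappa.

(** A quantity of order [N] absorbs an additive constant into a relative error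
    [err], with room to spare. *)
Lemma scale_err (y : R) i : err i ^+ 2 * (N i)%:R = 1 -> 0 < err i -> err i <= 1 ->
  kappa * (N i)%:R <= y -> kappa <= err i * y.
Proof.
move=> E r_gt0 r_le1 y_ge.
have NR : 1 <= err i * (N i)%:R.
  have : err i * (err i * (N i)%:R) <= err i * (N i)%:R.
    by rewrite ler_piMl // mulr_ge0 // ltW.
  by rewrite mulrA -expr2 E.
apply: le_trans (_ : err i * (kappa * (N i)%:R) <= _); last by rewrite ler_wpM2l // ltW.
by rewrite mulrCA ler_peMr // ltW.
Qed.

Lemma approx_shift (u y : I -> R) :
  (\forall i \near F, kappa * (N i)%:R <= y i) ->
  (\forall i \near F, `|u i - y i| <= 3) -> approx u y.
Proof.
move=> y_ge uy; exists (3 / kappa); first by rewrite divr_gt0.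
near=> i.
have E : err i ^+ 2 * (N i)%:R = 1 by near: i; apply: err_sqr.
have r_gt0 : 0 < err i by near: i; apply: err_gt0.
have r_le1 : err i <= 1 by near: i; apply: err_small.
have yi : kappa * (N i)%:R <= y i by near: i.
have uyi : `|u i - y i| <= 3 by near: i.
apply: le_trans uyi _; have := scale_err E r_gt0 r_le1 yi.
have k3 : 0 <= 3 / kappa by rewrite divr_ge0 // ltW.
by move/(ler_wpM2l k3); rewrite divfK ?lt0r_neq0 // mulrA.
Unshelve. all: by end_near. Qed.

Lemma approx_central_prob_sqr (m : I -> nat) :
  (\forall i \near F, kappa * (N i)%:R <= (m i)%:R) ->
  approx (fun i => central_prob R (m i) ^+ 2) (fun i => (pi * (m i)%:R)^-1).
Proof.
move=> m_ge; apply: (@approx_sandwich _ _ _ _ _ _ _ kappa^-1); first by rewrite invr_gt0.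
near=> i.
have E : err i ^+ 2 * (N i)%:R = 1 by near: i; apply: err_sqr.
have r_gt0 : 0 < err i by near: i; apply: err_gt0.
have r_le1 : err i <= 1 by near: i; apply: err_small.
have mi : kappa * (N i)%:R <= (m i)%:R by near: i.
have Ni : 0 < (N i)%:R :> R by rewrite ltr0n; near: i; apply: N_large.
have m_gt0 : 0 < (m i)%:R :> R by apply: lt_le_trans mi; rewrite mulr_gt0.
have rm := scale_err E r_gt0 r_le1 mi.
have [up lo] := central_prob_bounds R (m i).
have pm_gt0 : 0 < pi * (m i)%:R :> R by rewrite mulr_gt0 ?pi_gt0.
have e_ge0 : 0 <= kappa^-1 * err i by apply: mulr_ge0; [rewrite invr_ge0|]; exact: ltW.
split; last first.
  rewrite ler_pdivlMr // mulrC; lra.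
rewrite ler_pdivrMr // mulrC.
have me : 1 <= kappa^-1 * err i * (m i)%:R.
  by rewrite -mulrA -ler_pdivrMl ?invr_gt0 // invrK mulr1.
have P_ge0 : 0 <= pi * central_prob R (m i) ^+ 2 by rewrite mulr_ge0 ?sqr_ge0 ?pi_ge0.
rewrite -(ler_pM2r (_ : 0 < 2 * (m i)%:R + 1)); last by lra.
have := ler_wpM2l (ltW m_gt0) lo; nra.
Unshelve. all: by end_near. Qed.

(** The asymptotic form of [Cat(m) / 4 ^ m], with bounded shifts between
    the index, the divisor and the argument of the limit.  Working with squares avoids the roots:
    [approx_central_prob_sqr] is Wallis, and [approx_sqr] comes back. *)
Lemma approx_central (m : I -> nat) (z y : I -> R) :
  (\forall i \near F, kappa * (N i)%:R <= (m i)%:R) ->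
  (\forall i \near F, kappa * (N i)%:R <= y i) ->
  (\forall i \near F, kappa * (N i)%:R <= z i) ->
  (\forall i \near F, `|(m i)%:R - y i| <= 3) ->
  (\forall i \near F, `|z i - y i| <= 3) ->
  approx (fun i => central_prob R (m i) / z i) (fun i => (Num.sqrt pi * (y i) `^ (3 / 2))^-1).
Proof.
move=> m_ge y_ge z_ge my zy.
have pos (u : I -> R) : (\forall i \near F, kappa * (N i)%:R <= u i) ->
    \forall i \near F, 0 < u i.
  move=> u_ge; near=> i.
  have Ni : 0 < (N i)%:R :> R by rewrite ltr0n; near: i; apply: N_large.
  apply: lt_le_trans (_ : kappa * (N i)%:R <= _); first by rewrite mulr_gt0.
  by near: i.
have y_gt0 := pos _ y_ge; have z_gt0 := pos _ z_ge.
have pi_y : \forall i \near F, 0 < pi * y i.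
  by apply: filterS y_gt0 => i; rewrite pmulr_rgt0 ?pi_gt0.
have pi_pi : approx (fun=> pi) (fun=> pi).
  by apply: approx_eq => //; near=> i; split=> //; apply: pi_ge0.
have c2 : approx (fun i => central_prob R (m i) ^+ 2) (fun i => (pi * y i)^-1).
  apply: (approx_trans N_large (approx_central_prob_sqr m_ge)).
  by apply: (approxV N_large _ pi_y); apply: approxM => //; apply: approx_shift.
have zV : approx (fun i => (z i)^-1) (fun i => (y i)^-1).
  by apply: (approxV N_large _ y_gt0); apply: approx_shift.
have all3 : approx (fun i => central_prob R (m i) ^+ 2 * ((z i)^-1 * (z i)^-1))
    (fun i => (pi * y i)^-1 * ((y i)^-1 * (y i)^-1)).
  by apply: approxM => //; apply: approxM.
apply: approx_sqr => //.
- apply: (approx_trans N_large (g := fun i => (pi * y i)^-1 * ((y i)^-1 * (y i)^-1))).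
    apply: (approx_trans N_large _ all3).
    apply: approx_eq => //; near=> i; split; first by rewrite exprMn; ring.
    have : 0 < z i by near: i.
    by move=> zi; apply: mulr_ge0; [exact: sqr_ge0 | apply: mulr_ge0; rewrite invr_ge0 ltW].
  apply: approx_eq => //; near=> i.
  have yi : 0 < y i by near: i.
  split; last by rewrite sqr_ge0.
  rewrite exprVn exprMn sqr_sqrtr ?pi_ge0 // -powR_mulrn ?powR_ge0 // -powRrM.
  rewrite (_ : 3 / 2 * 2%:R = 3%:R); last by field.
  rewrite powR_mulrn ?ltW //.
  move: (@pi R) (pi_gt0 R) => p p_gt0; field.
  by rewrite (lt0r_neq0 yi) lt0r_neq0.
- by apply: filterS z_gt0 => i zi; rewrite divr_ge0 ?ltW ?central_prob_gt0.
apply: filterS y_gt0 => i yi; rewrite invr_gt0 mulr_gt0 ?sqrtr_gt0 ?pi_gt0 //.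
by rewrite powR_gt0.
Unshelve. all: by end_near. Qed.
End Asymptotics.

(** * The double sum and its decoupling *)

Section Coupled.
Variable R : realType.

(** The sum over the height [h] at which two pieces of path are joined. *)
Definition coupled (w : nat -> R) (a d : nat) : R :=
  \sum_(h < a.+1) w h * (4 ^+ h * (ballot a h)%:R * (ballot d h)%:R).

Lemma coupled_moment w a d :
  a.+1%:R * d.+1%:R * coupled w a d = moment (fun h => w h * h.+1%:R ^+ 2) a d.
Proof.
rewrite momentC -sum_ballot_moment; congr (_ * _); first exact: mulrC.
by apply: eq_bigr => h _; congr (_ * _); rewrite mulrAC.
Qed.

Lemma coupled_ge0 w a d : (forall h, 0 <= w h) -> 0 <= coupled w a d.
Proof. by move=> w_ge0; apply: sumr_ge0 => h _; rewrite !mulr_ge0 ?exprn_ge0. Qed.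

Notation ratio a d := (central_prob R a * central_prob R d / central_prob R (a + d)).

(** By [central_prob_bounds] the ratio is of order [sqrt ((a + d) / (a d))]. *)
Lemma ratio_le a d (rho : R) : (0 < a)%N -> (0 < d)%N -> 0 <= rho ->
  a%:R + d%:R <= rho ^+ 2 * (a%:R * d%:R) -> ratio a d <= rho.
Proof.
move=> a_gt0 d_gt0 rho_ge0 H.
have ca := central_prob_gt0 R a; have cd := central_prob_gt0 R d; have cs := central_prob_gt0 R (a + d).
have nn1 := mulr_ge0 (ltW ca) (ltW cd); have nn2 := mulr_ge0 rho_ge0 (ltW cs).
rewrite ler_pdivrMr // -(ler_sqr nn1 nn2).
have -> : (central_prob R a * central_prob R d) ^+ 2 =
    central_prob R a ^+ 2 * central_prob R d ^+ 2 by exact: exprMn.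
have -> : (rho * central_prob R (a + d)) ^+ 2 =
    rho ^+ 2 * central_prob R (a + d) ^+ 2 by exact: exprMn.
have [upa _] := central_prob_bounds R a; have [upd _] := central_prob_bounds R d.
have [_ los] := central_prob_bounds R (a + d).
have pi2 : 2 <= pi :> R by have := pihalf_ge1 R; lra.
have x1 : 1 <= a%:R :> R by rewrite ler1n.
have y1 : 1 <= d%:R :> R by rewrite ler1n.
move: upa upd los H; rewrite natrD.
move: (central_prob R a ^+ 2) (central_prob R d ^+ 2) (central_prob R (a + d) ^+ 2) (sqr_ge0 (central_prob R a))
  (sqr_ge0 (central_prob R d)) (sqr_ge0 (central_prob R (a + d))) (rho ^+ 2) (sqr_ge0 rho).
move=> A D S A_ge0 D_ge0 S_ge0 q q_ge0.
move: (a%:R) (d%:R) x1 y1 => x y x1 y1 upa upd los H.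
have up : pi ^+ 2 * (x * y) * (A * D) <= 1.
  have -> : pi ^+ 2 * (x * y) * (A * D) = (pi * x * A) * (pi * y * D) by ring.
  by rewrite mulr_ile1 // !mulr_ge0 //; lra.
have xy_gt0 : 0 < x * y by rewrite mulr_gt0; lra.
have P_gt0 : 0 < pi ^+ 2 * (x * y) by rewrite mulr_gt0 // exprn_gt0 // pi_gt0.
rewrite -(ler_pM2l P_gt0). apply: le_trans up _.
have PS_ge0 : 0 <= pi ^+ 2 * S by rewrite mulr_ge0 ?sqr_ge0.
have := ler_wpM2r PS_ge0 H.
have pp : 4 <= pi * (pi * (2 * (x + y) + 1) * S).
  by have := @ler_pM R 2 pi 2 _ (ler0n _ _) (ler0n _ _) pi2 los; lra.
have : pi * (pi * (2 * (x + y) + 1) * S) <= 4 * ((x + y) * (pi ^+ 2 * S)).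
  have : (2 * (x + y) + 1) * (pi ^+ 2 * S) <= 4 * (x + y) * (pi ^+ 2 * S).
    by rewrite ler_wpM2r //; lra.
  lra.
lra.
Qed.

Definition coupled_main a d : R :=
  2 * 4 ^+ (a + d) * (central_prob R (a + d) / (a + d)%:R).

(** [decay * (a + 1) (d + 1)] is close to [(a + d) / 2], so [square_moment_ge] and
    [square_moment_le] read [(a + d) / 2 * coupled] close to ['C(2s, s)] with
    [s = a + d].  All errors are at most multiples of a common bound [e] of
    [1 / a], [1 / d] and of the ratio of the central term to ['C(2s, s)]. *)
Lemma coupled_bounds a d (e : R) : (0 < a)%N -> (0 < d)%N -> e <= 1 ->
  1 <= e * a%:R -> 1 <= e * d%:R -> ratio a d <= e ->
  (1 - 20 * e) * coupled_main a d <= coupled (fun=> 1) a d <=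
  (1 + 20 * e) * coupled_main a d.
Proof.
move=> a_gt0 d_gt0 e_le1 ea ed er; set main := coupled_main a d.
have x_gt0 : 0 < a%:R :> R by rewrite ltr0n.
have y_gt0 : 0 < d%:R :> R by rewrite ltr0n.
have e_gt0 : 0 < e.
  by rewrite -(pmulr_lgt0 _ x_gt0); lra.
have k_gt0 := decay_gt0 R a_gt0 d_gt0.
have up := square_moment_le R a_gt0 d_gt0; have lo := square_moment_ge R a_gt0 d_gt0.
move: up lo; rewrite -(@eq_moment _ (fun h => 1 * h.+1%:R ^+ 2)) => [|h]; last exact: mul1r.
rewrite -coupled_moment /merged_bin !scaled_bin0 !bin_central_prob.
set S := coupled _ _ _.
rewrite exprD.
have c_gt0 := central_prob_gt0 R (a + d).
pose c : R := 4 ^+ a * 4 ^+ d * central_prob R (a + d).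
have cc_gt0 : 0 < c by rewrite mulr_gt0 // mulr_gt0 // exprn_gt0.
have gE : 4 ^+ a * central_prob R a * (4 ^+ d * central_prob R d) = ratio a d * c.
  move: c_gt0; rewrite /c; move: (central_prob R (a + d)) (central_prob R a) (central_prob R d) => z u v z_gt0.
  by field; rewrite lt0r_neq0.
rewrite gE -/c.
have r_ge0 : 0 <= ratio a d.
  by apply: divr_ge0; [apply: mulr_ge0|]; apply: ltW; apply: central_prob_gt0.
move: (ratio a d) er r_ge0 => r er r_ge0.
have k_le : decay R a d <= e.
  rewrite /decay ler_pdivrMr ?mulr_gt0 //; nra.
have kE : decay R a d * (a.+1%:R * d.+1%:R * S) =
    (a%:R + d%:R) / 2 * ((1 + a%:R^-1) * (1 + d%:R^-1)) * S.
  by rewrite /decay -[a.+1%:R]natr1 -[d.+1%:R]natr1; field; rewrite !lt0r_neq0.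
have mainE : main = 2 * c / (a%:R + d%:R) by rewrite /main /coupled_main /c natrD exprD; ring.
rewrite kE mainE.
have S_ge0 : 0 <= S by apply: coupled_ge0.
have s_gt0 : 0 < a%:R + d%:R :> R by rewrite addr_gt0.
have inv_a : 0 <= a%:R^-1 :> R /\ a%:R^-1 <= e.
  by split; [rewrite invr_ge0 ltW | rewrite -[_^-1]mul1r ler_pdivrMr].
have inv_d : 0 <= d%:R^-1 :> R /\ d%:R^-1 <= e.
  by split; [rewrite invr_ge0 ltW | rewrite -[_^-1]mul1r ler_pdivrMr].
move: (decay R a d) k_gt0 k_le => k k_gt0 k_le up lo.
move: (a%:R^-1) (d%:R^-1) inv_a inv_d up lo => u v [u0 ue] [v0 ve].
move: (a%:R + d%:R) s_gt0 => s s_gt0.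
pose Z := s / 2 * S.
have Z_ge0 : 0 <= Z by rewrite mulr_ge0 // divr_ge0 // ltW.
rewrite (_ : s / 2 * _ * S = (1 + u) * (1 + v) * Z); last by rewrite /Z; ring.
move=> up lo.
have SE : S = 2 * Z / s by rewrite /Z; field; rewrite lt0r_neq0.
have reduce (z1 z2 : R) : z1 <= z2 -> 2 * z1 / s <= 2 * z2 / s.
  by move=> z12; rewrite ler_wpM2r ?invr_ge0 ?(ltW s_gt0) // ler_wpM2l.
have uv1 : 1 <= (1 + u) * (1 + v) by nra.
have uv2 : (1 + u) * (1 + v) <= 1 + 3 * e by nra.
have rc : r * c <= e * c by rewrite ler_wpM2r // ltW.
have main_s z : z * (2 * c / s) = 2 * (z * c) / s by ring.
rewrite SE !main_s.
have ec_ge0 : 0 <= e * c by apply: mulr_ge0; exact: ltW.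
apply/andP; split; apply: reduce.
  have := ler_wpM2r Z_ge0 uv2 => Z_le.
  rewrite leNgt; apply/negP => Z_lt.
  have e3 : 0 < 1 + 3 * e by lra.
  have := Z_lt; rewrite -(ltr_pM2l e3) => Z_lt'.
  have e60 : 0 <= 1 + 60 * e by lra.
  have := mulr_ge0 ec_ge0 e60; lra.
have := ler_wpM2r Z_ge0 uv1; rewrite mul1r => Z_le.
have kc : (1 + k) * (c + 2 * (r * c)) <= (1 + e) * (c + 2 * (e * c)).
  have rc_ge0 : 0 <= r * c by apply: mulr_ge0 => //; exact: ltW.
  by apply: ler_pM; lra.
have e1 : 0 <= 1 - e by lra.
have := mulr_ge0 ec_ge0 e1; lra.
Qed.

(** The weighted mean of [h] is at most [16 e M]; as [e] is of order
    [1 / sqrt M], this says that [h] is of order [sqrt M] on average. *)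
Lemma coupled_first_moment_le a d (e M : R) : (0 < a)%N -> (0 < d)%N ->
  e <= 32^-1 -> ratio a d <= e -> a%:R <= M -> d%:R <= M ->
  coupled (fun h => h%:R) a d <= 16 * e * M * coupled (fun=> 1) a d.
Proof.
move=> a_gt0 d_gt0 e_le er aM dM.
have x_gt0 : 0 < a%:R :> R by rewrite ltr0n.
have y_gt0 : 0 < d%:R :> R by rewrite ltr0n.
have k_gt0 := decay_gt0 R a_gt0 d_gt0.
have lo := square_moment_ge R a_gt0 d_gt0; have up := cubic_moment_le R a_gt0 d_gt0.
move: lo up; rewrite -(@eq_moment _ (fun h => 1 * h.+1%:R ^+ 2)) => [|h]; last exact: mul1r.
rewrite -!coupled_moment /merged_bin !scaled_bin0 !bin_central_prob.
set S := coupled (fun=> 1) _ _; set S1 := coupled _ _ _.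
have S_ge0 : 0 <= S by apply: coupled_ge0.
have S1_ge0 : 0 <= S1 by apply: coupled_ge0.
have c_gt0 := central_prob_gt0 R (a + d).
rewrite exprD.
pose c : R := 4 ^+ a * 4 ^+ d * central_prob R (a + d).
have cc_gt0 : 0 < c by rewrite mulr_gt0 // mulr_gt0 // exprn_gt0.
have gE : 4 ^+ a * central_prob R a * (4 ^+ d * central_prob R d) = ratio a d * c.
  move: c_gt0; rewrite /c; move: (central_prob R (a + d)) (central_prob R a) (central_prob R d) => z u v z_gt0.
  by field; rewrite lt0r_neq0.
rewrite gE -/c.
have r_ge0 : 0 <= ratio a d.
  by apply: divr_ge0; [apply: mulr_ge0|]; apply: ltW; apply: central_prob_gt0.
have A_gt0 : 0 < a.+1%:R * d.+1%:R :> R by rewrite mulr_gt0.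
have kM : 1 <= decay R a d * M.
  rewrite /decay mulrAC ler_pdivlMr ?mulr_gt0 // mul1r.
  have := ler_wpM2l (ltW x_gt0) dM; have := ler_wpM2l (ltW y_gt0) aM; lra.
move: (ratio a d) er r_ge0 => r er r_ge0.
move: (decay R a d) k_gt0 kM => k k_gt0 kM.
move: (_ * _ : R) A_gt0 => A A_gt0 lo up.
have M_gt0 : 0 < M by apply: lt_le_trans aM.
have rc : r * c <= e * c by rewrite ler_wpM2r // ltW.
have ec : e * c <= 32^-1 * c by rewrite ler_wpM2r // ltW.
have c_le : c <= 2 * (k * (A * S)) by lra.
have e_ge0 : 0 <= e by lra.
have main : k * (A * (k * S1)) <= k * (A * (16 * e * S)).
  have := ler_wpM2l e_ge0 c_le; lra.
rewrite !(ler_pM2l k_gt0) (ler_pM2l A_gt0) in main.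
have := ler_wpM2l (ltW M_gt0) main; have := ler_wpM2r S1_ge0 kM; lra.
Qed.

Definition nested_sum (x a b c d : nat) : R :=
  (\sum_(h < a.+1) ballot a h * ballot d h *
    \sum_(k < b.+1) ballot b k * ballot c k * catalan (x + h + k + 1))%N%:R.

(** The Catalan factor is replaced by [4 ^ (h + k)] times its value at
    [h = k = 0]; the loss is linear in [h + k], hence a first moment. *)
Lemma nested_sum_bounds x a b c d :
  (catalan x.+1)%:R * (coupled (fun=> 1) a d * coupled (fun=> 1) b c -
     3 / (2 * x.+1%:R) * (coupled (fun h => h%:R) a d * coupled (fun=> 1) b c +
                          coupled (fun=> 1) a d * coupled (fun h => h%:R) b c)) <=
  nested_sum x a b c d <=
  (catalan x.+1)%:R * (coupled (fun=> 1) a d * coupled (fun=> 1) b c).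
Proof.
set C : R := (catalan x.+1)%:R.
pose f h : R := 4 ^+ h * (ballot a h)%:R * (ballot d h)%:R.
pose g k : R := 4 ^+ k * (ballot b k)%:R * (ballot c k)%:R.
have f_ge0 h : 0 <= f h by rewrite !mulr_ge0 ?exprn_ge0.
have g_ge0 h : 0 <= g h by rewrite !mulr_ge0 ?exprn_ge0.
have prodE (w1 w2 : nat -> R) : coupled w1 a d * coupled w2 b c =
    \sum_(h < a.+1) \sum_(k < b.+1) (w1 h * w2 k) * (f h * g k).
  rewrite big_distrl; apply: eq_bigr => h _; rewrite big_distrr; apply: eq_bigr => k _ /=.
  by rewrite -/(f h) -/(g k); ring.
(* Regrouped so that [catalan_addn_le] and [catalan_addn_ge] apply at [x.+1]. *)
have nested_sumE : nested_sum x a b c d = \sum_(h < a.+1) \sum_(k < b.+1)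
    ((ballot a h)%:R * (ballot d h)%:R * ((ballot b k)%:R * (ballot c k)%:R) *
      (catalan (x.+1 + (h + k)))%:R).
  rewrite /nested_sum natr_sum; apply: eq_bigr => h _; rewrite !natrM natr_sum big_distrr.
  apply: eq_bigr => k _ /=; rewrite !natrM !mulrA; congr (_ * (catalan _)%:R); lia.
have P_ge0 h k : 0 <= (ballot a h)%:R * (ballot d h)%:R * ((ballot b k)%:R * (ballot c k)%:R) :> R.
  by rewrite !mulr_ge0.
rewrite nested_sumE !prodE; apply/andP; split.
  rewrite -big_split big_distrr -sumrB big_distrr; apply: ler_sum => h _ /=.
  rewrite -big_split big_distrr -sumrB big_distrr; apply: ler_sum => k _ /=.
  have := ler_wpM2l (P_ge0 h k) (catalan_addn_ge R (h + k) (ltn0Sn x)).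
  rewrite natrD exprD -/C /f /g; apply: le_trans; rewrite le_eqVlt; apply/orP; left.
  by apply/eqP; move: (3 / _); move=> t; ring.
rewrite big_distrr; apply: ler_sum => h _ /=; rewrite big_distrr; apply: ler_sum => k _ /=.
have := ler_wpM2l (P_ge0 h k) (catalan_addn_le R x.+1 (h + k)).
rewrite exprD -/C /f /g => le_cat; apply: (le_trans le_cat); rewrite le_eqVlt.
by apply/orP; left; apply/eqP; ring.
Qed.
End Coupled.

Section CoupledAsymptotics.
Context {R : realType} {I : Type} {F : set_system I} {FF : Filter F}.
Variable N : I -> nat.
Hypothesis N_large : forall M : nat, \forall i \near F, (M <= N i)%N.
Local Notation err := (@err R I N).
Local Notation approx := (@approx R I F N).
Variable kappa : R.
Hypothesis kappa_gt0 : 0 < kappa.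
Local Notation linear a :=
  (\forall i \near F, kappa * (N i)%:R <= (a i)%:R /\ (a i)%:R <= (N i)%:R :> R).

Lemma near_scale (a : I -> nat) : linear a ->
  \forall i \near F, (0 < a i)%N /\ 1 <= err i / kappa * (a i)%:R.
Proof.
move=> a_lin; near=> i.
have E : err i ^+ 2 * (N i)%:R = 1 by near: i; apply: err_sqr.
have r_gt0 : 0 < err i by near: i; apply: err_gt0.
have r_le1 : err i <= 1 by near: i; apply: err_small.
have [a_ge _] : kappa * (N i)%:R <= (a i)%:R /\ (a i)%:R <= (N i)%:R :> R by near: i.
have Ni : 0 < (N i)%:R :> R by rewrite ltr0n; near: i; apply: N_large.
split; first by rewrite -(ltr0n R) (lt_le_trans _ a_ge) // mulr_gt0.
have := scale_err kappa_gt0 E r_gt0 r_le1 a_ge.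
by rewrite mulrAC ler_pdivlMr // mul1r.
Unshelve. all: by end_near. Qed.

Lemma near_ratio (a d : I -> nat) : linear a -> linear d ->
  (\forall i \near F, (a i + d i <= N i)%N) ->
  \forall i \near F,
    central_prob R (a i) * central_prob R (d i) / central_prob R (a i + d i) <= err i / kappa.
Proof.
move=> a_lin d_lin ad_le; have a_pos := near_scale a_lin; have d_pos := near_scale d_lin.
near=> i.
have E : err i ^+ 2 * (N i)%:R = 1 by near: i; apply: err_sqr.
have r_gt0 : 0 < err i by near: i; apply: err_gt0.
have [a_ge _] : kappa * (N i)%:R <= (a i)%:R /\ (a i)%:R <= (N i)%:R :> R by near: i.
have [d_ge _] : kappa * (N i)%:R <= (d i)%:R /\ (d i)%:R <= (N i)%:R :> R by near: i.
have [a_gt0 _] : (0 < a i)%N /\ 1 <= err i / kappa * (a i)%:R by near: i.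
have [d_gt0 _] : (0 < d i)%N /\ 1 <= err i / kappa * (d i)%:R by near: i.
have le_N : (a i + d i <= N i)%N by near: i.
apply: ratio_le => //; first by rewrite divr_ge0 // ltW.
apply: le_trans (_ : (N i)%:R <= _); first by rewrite -natrD ler_nat.
have kN_ge0 : 0 <= kappa * (N i)%:R by rewrite mulr_ge0 // ltW.
have := ler_pM kN_ge0 kN_ge0 a_ge d_ge.
have e_ge0 : 0 <= (err i / kappa) ^+ 2 by rewrite sqr_ge0.
move/(ler_wpM2l e_ge0); apply: le_trans; rewrite le_eqVlt; apply/orP; left; apply/eqP.
transitivity (err i ^+ 2 * (N i)%:R * (N i)%:R); first by rewrite E mul1r.
move: (err i) => r; by field; rewrite lt0r_neq0.
Unshelve. all: by end_near. Qed.

Lemma approx_coupled (a d : I -> nat) : linear a -> linear d ->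
  (\forall i \near F, (a i + d i <= N i)%N) ->
  approx (fun i => coupled (fun=> 1) (a i) (d i)) (fun i => coupled_main R (a i) (d i)).
Proof.
move=> a_lin d_lin ad_le; have a_pos := near_scale a_lin; have d_pos := near_scale d_lin.
have ratio_small := near_ratio a_lin d_lin ad_le.
apply: (@approx_sandwich _ _ _ _ _ _ _ (20 / kappa)); first by rewrite divr_gt0.
near=> i.
have [a_gt0 a_e] : (0 < a i)%N /\ 1 <= err i / kappa * (a i)%:R by near: i.
have [d_gt0 d_e] : (0 < d i)%N /\ 1 <= err i / kappa * (d i)%:R by near: i.
have e_le : err i / kappa <= 1.
  by rewrite ler_pdivrMr // mul1r; near: i; apply: err_small.
have r_le : central_prob R (a i) * central_prob R (d i) / central_prob R (a i + d i) <= err i / kappa by near: i.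
have /andP[lo up] := coupled_bounds a_gt0 d_gt0 e_le a_e d_e r_le.
by rewrite (_ : 20 / kappa * err i = 20 * (err i / kappa)) //; ring.
Unshelve. all: by end_near. Qed.

(** The first moments cost a relative error of order
    [sqrt N / x], which is of order [err] because [x] is of order [N]. *)
Lemma approx_nested_sum (x a b c d : I -> nat) :
  linear x -> linear a -> linear b -> linear c -> linear d ->
  (\forall i \near F, (a i + d i <= N i)%N) -> (\forall i \near F, (b i + c i <= N i)%N) ->
  approx (fun i => nested_sum R (x i) (a i) (b i) (c i) (d i))
    (fun i => (catalan (x i).+1)%:R *
              (coupled_main R (a i) (d i) * coupled_main R (b i) (c i))).
Proof.
move=> x_lin a_lin b_lin c_lin d_lin ad_le bc_le.
have cat_refl : approx (fun i => (catalan (x i).+1)%:R) (fun i => (catalan (x i).+1)%:R).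
  by apply: approx_eq => //; near=> i; split.
apply: (approx_trans N_large (g := fun i => (catalan (x i).+1)%:R *
    (coupled (fun=> 1) (a i) (d i) * coupled (fun=> 1) (b i) (c i)))); last first.
  by apply: approxM => //; apply: approxM => //; apply: approx_coupled.
apply: (@approx_sandwich _ _ _ _ _ _ _ (48 / kappa ^+ 2)).
  by rewrite divr_gt0 // exprn_gt0.
have a_pos := near_scale a_lin; have d_pos := near_scale d_lin.
have b_pos := near_scale b_lin; have c_pos := near_scale c_lin.
have ratio_ad := near_ratio a_lin d_lin ad_le; have ratio_bc := near_ratio b_lin c_lin bc_le.
near=> i.
have r_gt0 : 0 < err i by near: i; apply: err_gt0.
have [_ a_N] : kappa * (N i)%:R <= (a i)%:R /\ (a i)%:R <= (N i)%:R :> R by near: i.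
have [_ b_N] : kappa * (N i)%:R <= (b i)%:R /\ (b i)%:R <= (N i)%:R :> R by near: i.
have [_ c_N] : kappa * (N i)%:R <= (c i)%:R /\ (c i)%:R <= (N i)%:R :> R by near: i.
have [_ d_N] : kappa * (N i)%:R <= (d i)%:R /\ (d i)%:R <= (N i)%:R :> R by near: i.
have [x_ge _] : kappa * (N i)%:R <= (x i)%:R /\ (x i)%:R <= (N i)%:R :> R by near: i.
have [a_gt0 _] : (0 < a i)%N /\ 1 <= err i / kappa * (a i)%:R by near: i.
have [b_gt0 _] : (0 < b i)%N /\ 1 <= err i / kappa * (b i)%:R by near: i.
have [c_gt0 _] : (0 < c i)%N /\ 1 <= err i / kappa * (c i)%:R by near: i.
have [d_gt0 _] : (0 < d i)%N /\ 1 <= err i / kappa * (d i)%:R by near: i.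
have e_le : err i / kappa <= 32^-1.
  by rewrite ler_pdivrMr //; near: i; apply: (err_small N_large); rewrite mulr_gt0.
have r_ad : central_prob R (a i) * central_prob R (d i) / central_prob R (a i + d i) <= err i / kappa by near: i.
have r_bc : central_prob R (b i) * central_prob R (c i) / central_prob R (b i + c i) <= err i / kappa by near: i.
have S1_le := coupled_first_moment_le a_gt0 d_gt0 e_le r_ad a_N d_N.
have T1_le := coupled_first_moment_le b_gt0 c_gt0 e_le r_bc b_N c_N.
have /andP[lo up] := nested_sum_bounds R (x i) (a i) (b i) (c i) (d i).
have S_ge0 : 0 <= coupled (R := R) (fun=> 1) (a i) (d i) by apply: coupled_ge0.
have T_ge0 : 0 <= coupled (R := R) (fun=> 1) (b i) (c i) by apply: coupled_ge0.
move: lo up S_ge0 T_ge0 S1_le T1_le.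
have C_ge0 : 0 <= (catalan (x i).+1)%:R :> R by [].
have x_gt0 : 0 < (x i).+1%:R :> R by [].
have N_le : (N i)%:R <= (x i).+1%:R / kappa.
  rewrite ler_pdivlMr // mulrC (le_trans x_ge) // ler_nat; exact: leqnSn.
move: C_ge0 N_le (nested_sum _ _ _ _ _ _) (ler0n R (N i)).
move: ((catalan _)%:R : R) (coupled (fun=> 1) (a i) (d i)) (coupled (fun h => h%:R) (a i) (d i))
  (coupled (fun=> 1) (b i) (c i)) (coupled (fun h => h%:R) (b i) (c i)).
move: (x i).+1%:R x_gt0 (N i)%:R (err i) r_gt0 => y y_gt0 n r r_gt0.
move=> C S S1 T T1 C_ge0 n_le TL n_ge0 lo up S_ge0 T_ge0 S1_le T1_le.
set t := 3 / (2 * y) in lo.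
have t_ge0 : 0 <= t by rewrite divr_ge0 // mulr_ge0 // ltW.
have tn : t * n <= 3 / (2 * kappa).
  apply: le_trans (ler_wpM2l t_ge0 n_le) _.
  by rewrite /t le_eqVlt; apply/orP; left; apply/eqP; field; rewrite !lt0r_neq0.
have k_ge0 : 0 <= 16 * (r / kappa) by rewrite mulr_ge0 // divr_ge0 // ltW.
have := ler_wpM2l k_ge0 tn.
rewrite (_ : 16 * (r / kappa) * (3 / (2 * kappa)) = 24 * r / kappa ^+ 2); last first.
  by field; rewrite lt0r_neq0.
rewrite (_ : 48 / kappa ^+ 2 * r = 2 * (24 * r / kappa ^+ 2)); last by ring.
have : 0 <= 24 * r / kappa ^+ 2 by rewrite divr_ge0 ?mulr_ge0 ?sqr_ge0 // ltW.
move: (24 * r / _) => q q_ge0 tnq.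
have ST_ge0 : 0 <= S * T by rewrite mulr_ge0.
have CST_ge0 : 0 <= C * (S * T) by rewrite mulr_ge0.
split; last first.
  by apply: le_trans up _; have := mulr_ge0 q_ge0 CST_ge0; lra.
apply: le_trans lo; rewrite mulrCA ler_wpM2l //.
have h1 : S1 * T + S * T1 <= 2 * (16 * (r / kappa) * n) * (S * T).
  by have := ler_wpM2r T_ge0 S1_le; have := ler_wpM2l S_ge0 T1_le; lra.
have := ler_wpM2l t_ge0 h1; have := ler_wpM2r ST_ge0 tnq; lra.
Unshelve. all: by end_near. Qed.
End CoupledAsymptotics.

(** * Asymptotics of the probability *)

(** The five numbers of [card_Sdown], which determine [N], [j1], [j2], [t1], [t2];
    all separation conditions become lower bounds on them. *)
Record cuts := Cuts {cut_a : nat; cut_b : nat; cut_c : nat; cut_d : nat; cut_x : nat}.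

Definition cut_size p := (cut_x p + cut_a p + cut_b p + cut_c p + cut_d p + 3)%N.

Definition separated (R : realType) (kappa : R) (p : cuts) : Prop :=
  let bound := kappa * (cut_size p)%:R in
  [/\ bound <= (cut_a p)%:R, bound <= (cut_b p)%:R, bound <= (cut_c p)%:R,
      bound <= (cut_d p)%:R & bound <= (cut_x p)%:R].

(** Convergence along this filter is convergence as [N] tends to infinity,
    uniformly under the separation conditions. *)
Definition separated_at_infinity (R : realType) (kappa : R) : set_system cuts :=
  [set A | exists M : nat,
     forall p, (M <= cut_size p)%N -> separated kappa p -> A p]%classic.

Global Instance separated_at_infinity_filter (R : realType) (kappa : R) :
  Filter (separated_at_infinity kappa).
Proof.
split=> [|A B [M1 A1] [M2 B2]|A B AB [M A1]]; first by exists 0%N.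
  exists (maxn M1 M2) => p; rewrite geq_max => /andP[le1 le2] sep_p.
  by split; [apply: A1 | apply: B2].
by exists M => p le_M sep_p; apply/AB/A1.
Qed.

Lemma cut_size_large (R : realType) (kappa : R) (M : nat) :
  \forall p \near separated_at_infinity kappa, (M <= cut_size p)%N.
Proof. by exists M. Qed.

Lemma near_separated (R : realType) (kappa : R) :
  \forall p \near separated_at_infinity kappa, separated kappa p.
Proof. by exists 0%N. Qed.

Section Main.
Variables (R : realType) (kappa : R).
Hypothesis kappa_gt0 : 0 < kappa.
Local Notation F := (separated_at_infinity kappa).
Local Notation large := (@cut_size_large R kappa).
Local Notation linear f := (\forall p \near F,
  kappa * (cut_size p)%:R <= (f p)%:R /\ (f p)%:R <= (cut_size p)%:R :> R).

(** The limit form of [Cat(n) / 4 ^ n]. *)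
Definition scaled_catalan (y : R) : R := (Num.sqrt pi * y `^ (3 / 2))^-1.

(** The factor [1 / 4] is [4 ^ (x + 1) * 2 * 4 ^ (a + d) * 2 * 4 ^ (b + c)]
    divided by [4 ^ N]. *)
Definition density (p : cuts) : R :=
  4^-1 * (scaled_catalan (cut_x p)%:R *
   (scaled_catalan (cut_a p + cut_d p + 1)%:R * scaled_catalan (cut_b p + cut_c p + 2)%:R)) *
  (scaled_catalan (cut_size p)%:R)^-1.

Lemma approx_density : approx (R := R) (F := F) cut_size
  (fun p => nested_sum R (cut_x p) (cut_a p) (cut_b p) (cut_c p) (cut_d p) /
            (catalan (cut_size p))%:R) density.
Proof.
have lin (f : cuts -> nat) : (forall p, separated kappa p -> kappa * (cut_size p)%:R <= (f p)%:R) ->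
    (forall p, (f p <= cut_size p)%N) ->
    linear f.
  move=> f_ge f_le; apply: filterS (near_separated kappa) => p /f_ge ->.
  by rewrite ler_nat f_le.
have lin_a : linear cut_a.
  by apply: lin => p; [case | rewrite /cut_size; lia].
have lin_b : linear cut_b.
  by apply: lin => p; [case | rewrite /cut_size; lia].
have lin_c : linear cut_c.
  by apply: lin => p; [case | rewrite /cut_size; lia].
have lin_d : linear cut_d.
  by apply: lin => p; [case | rewrite /cut_size; lia].
have lin_x : linear cut_x.
  by apply: lin => p; [case | rewrite /cut_size; lia].
have ad_le : \forall p \near F, (cut_a p + cut_d p <= cut_size p)%N.
  by apply: nearW => p; rewrite /cut_size; lia.
have bc_le : \forall p \near F, (cut_b p + cut_c p <= cut_size p)%N.
  by apply: nearW => p; rewrite /cut_size; lia.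
have two := approx_nested_sum (FF := separated_at_infinity_filter kappa) large kappa_gt0
  lin_x lin_a lin_b lin_c lin_d ad_le bc_le.
have near_sum (f g : cuts -> nat) : linear f ->
    \forall p \near F, kappa * (cut_size p)%:R <= (f p + g p)%:R :> R.
  by apply: filterS => p [/le_trans le_f _]; apply: le_f; rewrite ler_nat leq_addr.
have piece (f m z y : cuts -> nat) : (forall p, (f p <= m p)%N) -> (forall p, (f p <= z p)%N) ->
    (forall p, (f p <= y p)%N) ->
    (forall p, (m p <= f p + 2)%N) -> (forall p, (z p <= f p + 2)%N) ->
    (forall p, (y p <= f p + 2)%N) ->
    (\forall p \near F, kappa * (cut_size p)%:R <= (f p)%:R) ->
    approx (R := R) (F := F) cut_size (fun p => central_prob R (m p) / (z p)%:R)
      (fun p => scaled_catalan (y p)%:R).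
  move=> fm fz fy mf zf yf f_lin.
  have le_lin (g : cuts -> nat) : (forall p, (f p <= g p)%N) ->
      \forall p \near F, kappa * (cut_size p)%:R <= (g p)%:R.
    by move=> fg; apply: filterS f_lin => p /le_trans; apply; rewrite ler_nat.
  have close (u v w : nat) : (w <= u)%N -> (w <= v)%N -> (u <= w + 2)%N -> (v <= w + 2)%N ->
      `|u%:R - v%:R| <= 3 :> R.
    rewrite -!(ler_nat R) !natrD => *; rewrite ler_norml; apply/andP; split; lra.
  apply: (approx_central large kappa_gt0 (m := m) (y := fun p => (y p)%:R)
      (z := fun p => (z p)%:R)); [exact: le_lin.. | |].
    by apply: nearW => p; apply: (close _ _ (f p)).
  by apply: nearW => p; apply: (close _ _ (f p)).
have px : approx (R := R) (F := F) cut_size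
    (fun p => central_prob R (cut_x p).+1 / (cut_x p + 2)%:R) (fun p => scaled_catalan (cut_x p)%:R).
  apply: (piece cut_x (fun p => (cut_x p).+1) (fun p => (cut_x p + 2)%N) cut_x);
    try by move=> p; lia.
  by apply: filterS lin_x => p [].
have pad : approx (R := R) (F := F) cut_size
    (fun p => central_prob R (cut_a p + cut_d p) / (cut_a p + cut_d p)%:R)
    (fun p => scaled_catalan (cut_a p + cut_d p + 1)%:R).
  apply: (piece (fun p => cut_a p + cut_d p)%N (fun p => (cut_a p + cut_d p)%N)
    (fun p => cut_a p + cut_d p)%N (fun p => (cut_a p + cut_d p + 1)%N));
    try by move=> p; lia.
  exact: near_sum.
have pbc : approx (R := R) (F := F) cut_size
    (fun p => central_prob R (cut_b p + cut_c p) / (cut_b p + cut_c p)%:R)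
    (fun p => scaled_catalan (cut_b p + cut_c p + 2)%:R).
  apply: (piece (fun p => cut_b p + cut_c p)%N (fun p => (cut_b p + cut_c p)%N)
    (fun p => cut_b p + cut_c p)%N (fun p => (cut_b p + cut_c p + 2)%N));
    try by move=> p; lia.
  exact: near_sum.
have pn : approx (R := R) (F := F) cut_size
    (fun p => central_prob R (cut_size p) / (cut_size p).+1%:R) (fun p => scaled_catalan (cut_size p)%:R).
  apply: (piece cut_size cut_size (fun p => (cut_size p).+1) cut_size);
    try by move=> p; lia.
  by apply: filterS lin_x => p [le1 le2]; apply: le_trans le1 le2.
have cat_gt0 : \forall p \near F, 0 < scaled_catalan (cut_size p)%:R.
  apply: nearW => p; rewrite invr_gt0 mulr_gt0 ?sqrtr_gt0 ?pi_gt0 // powR_gt0 //.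
  by rewrite ltr0n /cut_size; lia.
have quarter : approx (R := R) (F := F) cut_size (fun=> 4^-1) (fun=> 4^-1).
  by apply: approx_eq => //; [exact: large | apply: nearW => p; split; rewrite // invr_ge0].
have inv_cat : approx (R := R) (F := F) cut_size
    (fun p => ((catalan (cut_size p))%:R)^-1) (fun p => ((catalan (cut_size p))%:R)^-1).
  by apply: approx_eq; [exact: large | apply: nearW => p; split; rewrite // invr_ge0].
apply: (approx_trans large (approxM large two inv_cat)).
apply: (approx_trans large _ (approxM large (approxM large quarter
  (approxM large px (approxM large pad pbc))) (approxV large pn cat_gt0))).
apply: approx_eq; first exact: large.
apply: nearW => p; split; last first.
  rewrite mulr_ge0 // ?invr_ge0 ?divr_ge0 ?(ltW (central_prob_gt0 _ _)) //.
  by rewrite mulr_ge0 // ?mulr_ge0 // divr_ge0 // ltW ?central_prob_gt0.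
have nz : central_prob R (cut_size p) != 0 by rewrite lt0r_neq0 // central_prob_gt0.
have pow4 : 4 ^+ cut_size p =
    64 * (4 ^+ (cut_x p) * 4 ^+ (cut_a p + cut_d p) * 4 ^+ (cut_b p + cut_c p)) :> R.
  rewrite -!exprD (_ : 64 = 4 ^+ 3); last by ring.
  by rewrite -exprD; congr (_ ^+ _); rewrite /cut_size; lia.
have x2 : (cut_x p + 2)%:R = (cut_x p).+1%:R + 1 :> R by rewrite natr1 addn2.
have n1 : (cut_size p).+1%:R = (cut_size p)%:R + 1 :> R by rewrite natr1.
rewrite /coupled_main !catalan_central_prob pow4 exprS x2 n1.
have nz' : central_prob R (cut_size p) / ((cut_size p)%:R + 1) != 0.
  by rewrite mulf_neq0 // invr_neq0 // natr1 pnatr_eq0.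
move: (_ / _) nz'.
move: (central_prob R (cut_x p).+1 / _) (central_prob R (cut_a p + cut_d p) / _) (central_prob R (cut_b p + cut_c p) / _).
move=> u v w t t_nz.
have p4 k : 4 ^+ k != 0 :> R by rewrite expf_neq0.
move: (4 ^+ _) (4 ^+ _) (4 ^+ _) (p4 (cut_x p)) (p4 (cut_a p + cut_d p)%N)
  (p4 (cut_b p + cut_c p)%N) => A B C A0 B0 C0.
by field; rewrite A0 B0 C0 t_nz.
Qed.
End Main.

Lemma scaled_catalan_gt0 (R : realType) (y : R) : 0 < y -> 0 < scaled_catalan y.
Proof.
by move=> y_gt0; rewrite invr_gt0 mulr_gt0 ?sqrtr_gt0 ?pi_gt0 // powR_gt0.
Qed.

Lemma density_gt0 (R : realType) p : (0 < cut_x p)%N -> 0 < density R p.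
Proof.
move=> x_gt0; apply: mulr_gt0; last first.
  by rewrite invr_gt0 scaled_catalan_gt0 // ltr0n /cut_size addnS.
apply: mulr_gt0; first by rewrite invr_gt0.
apply: mulr_gt0; first by rewrite scaled_catalan_gt0 // ltr0n.
by apply: mulr_gt0; rewrite scaled_catalan_gt0 // ltr0n addnS.
Qed.

Lemma scaled_catalan_quotient (R : realType) (n y1 y2 y3 : R) :
    0 < n -> 0 < y1 -> 0 < y2 -> 0 < y3 ->
  4^-1 * (scaled_catalan y1 * (scaled_catalan y3 * scaled_catalan y2)) *
    (scaled_catalan n)^-1 =
  1 / (4 * pi) *
    (n ^- 3 / ((y2 / n) `^ (3 / 2) * (y1 / n) `^ (3 / 2) * (y3 / n) `^ (3 / 2))).
Proof.
move=> n_gt0 y1_gt0 y2_gt0 y3_gt0.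
have divE y : 0 < y -> (y / n) `^ (3 / 2) = y `^ (3 / 2) / n `^ (3 / 2).
  move=> y_gt0; have nz : n `^ (3 / 2) != 0 by rewrite lt0r_neq0 // powR_gt0.
  apply: (mulIf nz); rewrite -powRM ?divr_ge0 ?(ltW y_gt0) ?(ltW n_gt0) //.
  by rewrite !divfK // lt0r_neq0.
rewrite !divE //.
have n3 : n ^+ 3 = n `^ (3 / 2) ^+ 2.
  rewrite -[RHS]powR_mulrn ?powR_ge0 // -powRrM (_ : 3 / 2 * 2%:R = 3%:R); last by field.
  by rewrite powR_mulrn // ltW.
have pi2 : pi = Num.sqrt pi ^+ 2 :> R by rewrite sqr_sqrtr // pi_ge0.
have sp : 0 < Num.sqrt pi :> R by rewrite sqrtr_gt0 pi_gt0.
rewrite /scaled_catalan n3 [in RHS]pi2.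
move: (Num.sqrt pi) sp (n `^ (3 / 2)) (y1 `^ (3 / 2)) (y2 `^ (3 / 2)) (y3 `^ (3 / 2))
  (@powR_gt0 R n (3 / 2) n_gt0) (@powR_gt0 R y1 (3 / 2) y1_gt0)
  (@powR_gt0 R y2 (3 / 2) y2_gt0) (@powR_gt0 R y3 (3 / 2) y3_gt0).
move=> s s0 p q1 q2 q3 p0 q10 q20 q30.
by field; rewrite !lt0r_neq0.
Qed.

Definition cuts_of (N j1 j2 t1 t2 : nat) : cuts :=
  Cuts j2.-1 (j1 - j2).-1 (t1 - t2).-1 t2 (N - t1 - j1).

Section CutsOf.
Variables N j1 j2 t1 t2 : nat.
Hypotheses (j2_gt0 : (0 < j2)%N) (lt_j : (j2 < j1)%N) (lt_t : (t2 < t1)%N)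
  (lt_tj : (t1 + j1 < N)%N).
Notation p := (cuts_of N j1 j2 t1 t2).

Lemma cut_size_of : cut_size p = N.
Proof. rewrite /cut_size /=; lia. Qed.

Lemma cuts_ofE (R : realType) :
  [/\ (cut_a p)%:R = j2%:R - 1 :> R, (cut_b p)%:R = j1%:R - j2%:R - 1 :> R,
      (cut_c p)%:R = t1%:R - t2%:R - 1 :> R & (cut_x p)%:R = N%:R - t1%:R - j1%:R :> R].
Proof. by split; rewrite /= -?subn1 !natrB //; lia. Qed.

Lemma Sdown_cuts : Sdown N t1 t2 j1 j2 =
  Sdown N (cut_c p + cut_d p).+1 (cut_d p) (cut_a p + cut_b p).+2 (cut_a p).+1.
Proof. congr Sdown => /=; lia. Qed.

Lemma P312_Sdown_cuts (R : realType) : P312 R (Sdown N t1 t2 j1 j2) =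
  nested_sum R (cut_x p) (cut_a p) (cut_b p) (cut_c p) (cut_d p) / (catalan N)%:R.
Proof.
rewrite /P312 (finset.setIidPl _); last by apply/fintype.subsetP => s; rewrite !inE => /andP[].
by rewrite card_S312 /nested_sum -card_Sdown -/(cut_size p) cut_size_of -Sdown_cuts.
Qed.
End CutsOf.

Theorem theorem2p9 (R : realType) (theta : R)
    (theta_gt0 : 0 < theta) (theta_lt : theta < 1 / 6) (eps : R) (eps_gt0 : 0 < eps) :
  exists (C : R) (N1 : nat), forall N j1 j2 t1 t2 : nat, (N1 <= N)%N ->
    let n : R := N%:R in
    let x1 : R := n - t1%:R - j1%:R in
    let x2 : R := n - t2%:R - j2%:R in
    Num.min j2%:R (Num.min (j1%:R - j2%:R)
      (Num.min x1 (Num.min (t1%:R - t2%:R) t2%:R))) > eps * n ->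
    exists delta : R,
      `|delta| <= C * n `^ (3 * theta - 1 / 2) /\
      P312 R (Sdown N t1 t2 j1 j2) =
        1 / (4 * pi) *
        (n ^- 3 / (((x2 - x1) / n) `^ (3 / 2) * (x1 / n) `^ (3 / 2) *
                   (1 - x2 / n) `^ (3 / 2))) *
        (1 + delta).
Proof.
have half_gt0 : 0 < eps / 2 by rewrite divr_gt0.
have [K K_gt0 [M close]] := approx_density half_gt0.
(* Beyond [2 / eps], the shifts by 1 in the cuts cost at most half of [eps]. *)
pose N0 := (Num.truncn (2 / eps)).+1.
exists K, (maxn M N0) => N j1 j2 t1 t2; rewrite geq_max => /andP[le_MN le_N0N] n x1 x2.
rewrite !lt_min => /and5P[j2_gt j12_gt x1_gt t12_gt t2_gt].
have n_ge : 2 / eps <= n.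
  by apply: le_trans (_ : N0%:R <= _); [rewrite ltW // truncnS_gt | rewrite ler_nat].
have n_gt0 : 0 < n by apply: lt_le_trans n_ge; rewrite divr_gt0.
have en_ge : 2 <= eps * n by move: n_ge; rewrite ler_pdivrMr // mulrC.
have j2_pos : (0 < j2)%N by rewrite -(ltr_nat R); lra.
have lt_j : (j2 < j1)%N by rewrite -(ltr_nat R); lra.
have lt_t : (t2 < t1)%N by rewrite -(ltr_nat R); lra.
have lt_tj : (t1 + j1 < N)%N by rewrite -(ltr_nat R) natrD; rewrite /x1 /n in x1_gt; lra.
pose p := cuts_of N j1 j2 t1 t2.
have sizeE : cut_size p = N by apply: cut_size_of.
have [aE bE cE xE] := cuts_ofE j2_pos lt_j lt_t lt_tj R.
rewrite -/p -/n -/x1 in aE bE cE xE.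
have sep_p : separated (eps / 2) p.
  by rewrite /separated sizeE -/n aE bE cE xE /=; split; lra.
have /= := close p; rewrite sizeE => /(_ le_MN sep_p).
have N_gt0 : (0 < N)%N by rewrite -(ltr0n R).
have densE : density R p = 1 / (4 * pi) *
    (n ^- 3 / (((x2 - x1) / n) `^ (3 / 2) * (x1 / n) `^ (3 / 2) * (1 - x2 / n) `^ (3 / 2))).
  rewrite /density sizeE scaled_catalan_quotient //; try by rewrite ltr0n addnS.
    2: by rewrite xE; lra.
  have -> : (cut_b p + cut_c p + 2)%:R = x2 - x1.
    by rewrite !natrD bE cE /x1 /x2; ring.
  have -> : (cut_a p + cut_d p + 1)%:R / n = 1 - x2 / n.
    by rewrite !natrD aE /x2 /=; field; exact: lt0r_neq0.
  by rewrite xE.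
rewrite -P312_Sdown_cuts // => close_p.
set D := density R p in close_p densE.
have D_gt0 : 0 < D by apply: density_gt0; rewrite -(ltr0n R) xE; lra.
exists (P312 R (Sdown N t1 t2 j1 j2) / D - 1); split; last first.
  by rewrite -densE addrC subrK mulrC divfK // lt0r_neq0.
have err_le : err (R := R) cut_size p <= n `^ (3 * theta - 1 / 2).
  rewrite /err sizeE -/n -powR12_sqrt ?(ltW n_gt0) // -powRN ler_powR //; last by lra.
  by rewrite ler1n.
apply: le_trans (_ : K * err (R := R) cut_size p <= _); last by rewrite ler_pM2l.
rewrite -(ler_pM2r D_gt0); apply: le_trans close_p; rewrite -{2}(gtr0_norm D_gt0) -normrM.
by rewrite mulrBl divfK ?lt0r_neq0 // mul1r.
Qed.
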